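(* For every integer $N\ge 2$, the protocol $P_{RL}$ (with parameter $N$, defined in the context) is a self-stabilizing leader election protocol on every directed ring of any size $n$ with $2\le n\le N$. Its expected convergence time is $O(nN)$ and its number of states is $O(N)$, where the constants hidden in $O(\cdot)$ do not depend on $n$ or $N$.
   Context: Model. A population is a directed ring of $n\ge 2$ anonymous agents $u_0,\dots,u_{n-1}$ (indices modulo $n$) with arc set $E=\{e_i=(u_i,u_{i+1}) : 0\le i\le n-1\}$. A protocol has a finite state set $Q$, a transition function $T:Q\times Q\to Q\times Q$ and an output function. A configuration is a map $C:V\to Q$. For an arc $e_i$, $C\xrightarrow{e_i}C'$ means $(C'(u_i),C'(u_{i+1}))=T(C(u_i),C(u_{i+1}))$ ($u_i$ is the initiator, $u_{i+1}$ the responder) and $C'(v)=C(v)$ for all other $v$; $C\to C'$ means $C\xrightarrow{e}C'$ for some $e\in E$. A configuration is reachable from $C$ if it is obtained from $C$ by finitely many such steps. The uniformly random scheduler chooses at each step $t=0,1,2,\dots$ an arc $\Gamma_t\in E$ uniformly at random (probability $1/n$ each), independently; the execution from $C_0$ is $C_0,C_1,\dots$ with $C_t\xrightarrow{\Gamma_t}C_{t+1}$. Self-stabilizing leader election. A configuration $C$ is safe if (i) exactly one agent outputs $L$ and all others output $F$ in $C$, and (ii) in every configuration reachable from $C$ every agent has the same output as in $C$. A protocol is a self-stabilizing leader election protocol if from every initial configuration its execution reaches a safe configuration with probability $1$. Its expected convergence time is the maximum over all initial configurations $C$ of the expected number of steps until the execution from $C$ reaches a safe configuration. Its number of states is $|Q|$.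 Protocol $P_{RL}$ (parameter $N$). Each agent has variables $\mathit{leader}\in\{0,1\}$, $\mathit{bullet}\in\{0,1,2\}$, $\mathit{shield}\in\{0,1\}$, $\mathit{signal}\in\{0,1\}$, $\mathit{dist}\in\{0,1,\dots,N\}$; an agent outputs $L$ if $\mathit{leader}=1$ and $F$ otherwise. In an interaction with initiator $l$ and responder $r$ the following are executed in order (each line uses the current values after the previous lines): 1. If $l.\mathit{leader}=1$ then $l.\mathit{dist}\gets 0$. 2. If $r.\mathit{leader}=1$ then $r.\mathit{dist}\gets 0$; else if $r.\mathit{bullet}=0$ then $r.\mathit{dist}\gets\min(l.\mathit{dist}+1,N)$. 3. If $r.\mathit{dist}=N$ then $r.\mathit{leader}\gets1$, $r.\mathit{bullet}\gets2$, $r.\mathit{shield}\gets1$, $r.\mathit{signal}\gets0$, $r.\mathit{dist}\gets0$. 4. If $l.\mathit{leader}=1$ and $l.\mathit{signal}=1$ then $l.\mathit{bullet}\gets2$, $l.\mathit{shield}\gets1$, $l.\mathit{signal}\gets0$. 5. If $r.\mathit{leader}=1$ and $r.\mathit{signal}=1$ then $r.\mathit{bullet}\gets1$, $r.\mathit{shield}\gets0$, $r.\mathit{signal}\gets0$. 6. If $l.\mathit{bullet}>0$ and $r.\mathit{leader}=1$: set $r.\mathit{leader}\gets0$ if ($l.\mathit{bullet}=2$ and $r.\mathit{shield}=0$), otherwise leave it $1$; then $l.\mathit{bullet}\gets0$. Else, if $l.\mathit{bullet}>0$ and $r.\mathit{leader}=0$: if $r.\mathit{bullet}=0$ then $r.\mathit{bullet}\gets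 l.\mathit{bullet}$; then $l.\mathit{bullet}\gets0$ and $r.\mathit{signal}\gets0$. 7. $l.\mathit{signal}\gets\max(l.\mathit{signal},r.\mathit{signal},r.\mathit{leader})$. *)

(* Defs.v *)
From HB Require Import structures.
From mathcomp Require Import all_boot all_order all_algebra.
Set Implicit Arguments. Unset Strict Implicit. Unset Printing Implicit Defensive.
Import Order.TTheory GRing.Theory Num.Theory.

(* Unpacked agent record (values of bullet in {0,1,2}, dist in {0..N}). *)
Record agent := Agent { ld : bool; bu : nat; sh : bool; sg : bool; di : nat }.

(* The finite state set Q: leader x bullet x shield x signal x dist. *)
Definition state (N : nat) : finType :=
  (bool * 'I_3 * bool * bool * 'I_N.+1)%type.

Definition decode N (q : state N) : agent :=
  let: (l, b, s, g, d) := q in Agent l b s g d.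
Definition encode N (a : agent) : state N :=
  (ld a, inord (bu a), sh a, sg a, inord (di a)).

Definition outputL N (q : state N) : bool := ld (decode q).

Definition set_di (a : agent) d := Agent (ld a) (bu a) (sh a) (sg a) d.

(* The interaction (initiator l, responder r), lines 1-7 executed in order. *)
Definition interact (N : nat) (l r : agent) : agent * agent :=
  let l := if ld l then set_di l 0 else l in
  let r := if ld r then set_di r 0
           else if bu r == 0 then set_di r (minn (di l).+1 N) else r in
  let r := if di r == N then Agent true 2 true false 0 else r in
  let l := if ld l && sg l then Agent (ld l) 2 true false (di l) else l in
  let r := if ld r && sg r then Agent (ld r) 1 false false (di r) else r in
  let '(l, r) :=
    if (0 < bu l) && ld r then
      (Agent (ld l) 0 (sh l) (sg l) (di l),
       Agent (if (bu l == 2) && ~~ sh r then false else true)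
             (bu r) (sh r) (sg r) (di r))
    else if (0 < bu l) && ~~ ld r then
      (Agent (ld l) 0 (sh l) (sg l) (di l),
       Agent (ld r) (if bu r == 0 then bu l else bu r) (sh r) false (di r))
    else (l, r) in
  let l := Agent (ld l) (bu l) (sh l) (sg l || sg r || ld r) (di l) in
  (l, r).

Definition T (N : nat) (ql qr : state N) : state N * state N :=
  let: (l', r') := interact N (decode ql) (decode qr) in
  (encode N l', encode N r').

Definition config (N n : nat) : finType := {ffun 'I_n -> state N}.

Definition step (N n : nat) (i : 'I_n) (C : config N n) : config N n :=
  let j := ordS i in
  let qq := T (C i) (C j) in
  [ffun k => if k == i then qq.1 else if k == j then qq.2 else C k].

Definition step_rel (N n : nat) : rel (config N n) :=
  fun C C' => [exists i : 'I_n, C' == step i C].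

Definition reachable (N n : nat) (C C' : config N n) : bool :=
  connect (@step_rel N n) C C'.

Definition safe (N n : nat) (C : config N n) : bool :=
  (#|[set u : 'I_n | outputL (C u)]| == 1%N) &&
  [forall C' : config N n, reachable C C' ==>
      [forall u : 'I_n, outputL (C' u) == outputL (C u)]].

Definition exec (N n : nat) (C : config N n) (g : seq 'I_n) (s : nat) :
  config N n := foldl (fun D i => step i D) C (take s g).

(* Probability that the execution from C is in a safe configuration at some
   step s <= t, i.e. P(T_conv <= t): the first t arcs are i.i.d. uniform on E,
   so every schedule prefix of length t has probability 1/n^t. *)
Definition prob_conv_by (N n : nat) (C : config N n) (t : nat) : rat :=
  (#|[pred g : t.-tuple 'I_n | [exists s : 'I_t.+1, safe (exec C g s)]]|%:R
    / (n ^ t)%:R)%R.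

(* Reaches a safe configuration with probability 1:
   P(T_conv < oo) = lim_t P(T_conv <= t) = 1. *)
Definition converges_as (N n : nat) (C : config N n) : Prop :=
  forall eps : rat, (0 < eps)%R ->
    exists t, (1 - eps <= prob_conv_by C t)%R.

(* E[T_conv] = sum_{t>=0} P(T_conv > t) <= B, i.e. (nonnegative terms) all
   partial sums of the tail-sum series are bounded by B. *)
Definition expected_conv_le (N n : nat) (C : config N n) (B : rat) : Prop :=
  forall m : nat, (\sum_(t < m) (1 - prob_conv_by C t) <= B)%R.

Definition ss_leader_election (N n : nat) : Prop :=
  forall C : config N n, converges_as C.

(* Main.v *)
(** A live bullet is good when the leader behind it is shielded and neither a signal
    nor a wrong distance lies between them.  Good bullets stay good, and every other live
    bullet raises the [di] value of its holder with each move until it reaches [N] and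
    vanishes in the creation of a leader.  Hence the sum of [2 ^ (- di)] over the bad
    bullets shrinks by the factor [1 - 1 / (2 n)] per step in expectation, and only good
    bullets remain after O(nN) steps.  A similar sum forces a leader to appear when there is
    none; from then on some leader survives, because a good bullet never kills the leader
    that fired it.  The correct distances then spread along the ring in O(n^2) steps, after
    which no leader is created any more, and in O(nN) further steps the bullets with a
    signal behind them disappear.

    For the elimination of the surplus leaders, consecutive leaders [u] and [v] at
    distances [gu] and [gv] from their successors carry a bounded potential whose expected
    change per step is at most [- 1 / (32 n (gu + gv))].  It contains the probability that
    [v] is unshielded when the next bullet of [u] arrives, which is governed by a race: if
    the coin of [v] is tossed again before the arrival, the shield is a fair coin.  Adding
    52 for each of the [m] leaders makes a kill profitable in spite of the pairs it
    disturbs, so by convexity the total [Y] has drift at most [- c m^2 / n^2].  As [Y] is of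
    order [m], the drift of [- 1 / Y] is at most [- c' / n^2], whence a single leader is
    left after O(n^2) expected steps. *)

Require Import Defs.
From mathcomp Require Import all_boot all_order all_algebra.
From mathcomp Require Import ring lra zify.
Set Implicit Arguments. Unset Strict Implicit. Unset Printing Implicit Defensive.
Import Order.TTheory GRing.Theory Num.Theory.

(** * Hitting times of a uniformly driven chain *)

Section Chain.
Local Open Scope ring_scope.
Variables (R : realFieldType) (X : finType) (n : nat) (stp : 'I_n -> X -> X).
Hypothesis n_gt0 : (0 < n)%N.
Implicit Types (S : pred X) (C : X) (t : nat).

(* Probability that the chain started in [C] avoids [S] at the times [0, ..., t]. *)
Fixpoint nohit (S : pred X) (t : nat) (C : X) : R :=
  if S C then 0
  else if t is t'.+1 then (\sum_i nohit S t' (stp i C)) / n%:R else 1.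

Definition run (C : X) (g : seq 'I_n) (s : nat) : X :=
  foldl (fun D i => stp i D) C (take s g).

Lemma nohitS S t C :
  nohit S t.+1 C = if S C then 0 else (\sum_i nohit S t (stp i C)) / n%:R.
Proof. by []. Qed.

Lemma nohit_in S t C : S C -> nohit S t C = 0.
Proof. by case: t => [|t] /= ->. Qed.

Let n_neq0 : n%:R != 0 :> R. Proof. by rewrite pnatr_eq0 -lt0n. Qed.
Let n_pos : 0 < n%:R :> R. Proof. by rewrite ltr0n. Qed.

Lemma sum_const_ord (x : R) : \sum_(i < n) x = n%:R * x.
Proof. by rewrite sumr_const card_ord mulr_natl. Qed.

Lemma avg_le (F : 'I_n -> R) x : (forall i, F i <= x) -> (\sum_i F i) / n%:R <= x.
Proof.
move=> FP; rewrite ler_pdivrMr // mulrC -sum_const_ord.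
by apply: ler_sum => i _.
Qed.

Lemma nohit_ge0 S t C : 0 <= nohit S t C.
Proof.
elim: t C => [|t IH] C /=; case: ifP => // _.
by rewrite divr_ge0 ?ler0n // sumr_ge0.
Qed.

Lemma nohit_le1 S t C : nohit S t C <= 1.
Proof.
by elim: t C => [|t IH] C /=; case: ifP => // _; apply: avg_le.
Qed.

Lemma nohit_leS S t C : nohit S t.+1 C <= nohit S t C.
Proof.
elim: t C => [|t IH] C.
  rewrite /=; case: ifP => // _; apply: avg_le => i.
  exact: (nohit_le1 S 0).
rewrite nohitS [leRHS]nohitS; case: ifP => // _.
by rewrite ler_pM2r ?invr_gt0 // ler_sum.
Qed.

Lemma nohit_mono S s t C : (s <= t)%N -> nohit S t C <= nohit S s C.
Proof.
move=> /subnKC <-; elim: (t - s)%N => [|k IH]; first by rewrite addn0.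
by rewrite addnS; apply: le_trans (nohit_leS _ _ _) IH.
Qed.

Lemma nohit_comp (B D : pred X) (q1 q2 : R) t1 t2 C :
  (forall C, B C -> nohit D t2 C <= q2) -> nohit B t1 C <= q1 -> 0 <= q2 ->
  nohit D (t1 + t2) C <= q1 + q2.
Proof.
move=> Bq Cq q2_ge0; apply: le_trans (lerD Cq (lexx q2)) => {Cq}.
elim: t1 C => [|t IH] C.
  rewrite add0n [nohit B 0 C]/=; case: ifP => [/Bq|_]; first by rewrite add0r.
  by apply: le_trans (nohit_le1 _ _ _) _; rewrite lerDl.
rewrite addSn; have [BC|BC] := boolP (B C).
  rewrite (nohit_in _ BC) add0r -addSn (le_trans _ (Bq _ BC)) //.
  by rewrite nohit_mono // leq_addl.
rewrite !nohitS (negbTE BC); case: ifP => _.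
  by rewrite addr_ge0 // divr_ge0 ?ler0n // sumr_ge0 // => i _; apply: nohit_ge0.
rewrite -[q2](mulfK n_neq0) -mulrDl ler_pM2r ?invr_gt0 // [q2 * _]mulrC.
by rewrite -sum_const_ord -big_split ler_sum.
Qed.

Lemma nohit_mult_drift (A B : pred X) (f : X -> R) (eps : R) :
  (forall C, A C -> ~~ B C -> forall i, A (stp i C)) ->
  (forall C, 0 <= f C) -> 0 < eps ->
  (forall C, A C -> ~~ B C -> eps <= f C) ->
  (forall C, A C -> ~~ B C ->
     \sum_i (if B (stp i C) then 0 else f (stp i C)) <= (n%:R - 1/2) * f C) ->
  forall t C, A C -> ~~ B C ->
  nohit B t C <= f C / eps * (1 - (2 * n%:R)^-1) ^+ t.
Proof.
move=> Acl f_ge0 eps_gt0 f_ge drift; elim=> [|t IH] C AC BC.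
  by rewrite expr0 mulr1 /= (negbTE BC) ler_pdivlMr // mul1r f_ge.
rewrite nohitS (negbTE BC) ler_pdivrMr //.
set r := 1 - _ : R.
have r_ge0 : 0 <= r.
  have : (1 : R) <= n%:R by rewrite ler1n.
  by move=> n1; rewrite subr_ge0 invf_le1; lra.
have -> : f C / eps * r ^+ t.+1 * n%:R = (n%:R - 1/2) * f C * (r ^+ t / eps).
  by rewrite exprS /r; field; rewrite n_neq0 gt_eqF.
apply: le_trans (_ : _ <= (\sum_i (if B (stp i C) then 0 else f (stp i C))) * (r ^+ t / eps)) _.
  rewrite mulr_suml; apply: ler_sum => i _; case: ifP => [Bi|/negbT Bi].
    by rewrite mul0r nohit_in.
  by rewrite (le_trans (IH _ (Acl _ AC BC i) Bi)) // mulrA mulrAC.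
by apply: ler_wpM2r; [rewrite divr_ge0 ?exprn_ge0 // ltW | apply: drift].
Qed.

Lemma half_pow : (1 - (2 * n%:R)^-1) ^+ (2 * n) <= 2^-1 :> R.
Proof.
set m := (2 * n)%N.
have m_gt1 : (1 < m)%N by rewrite /m; lia.
have -> : (2 * n%:R)^-1 = m%:R^-1 :> R by rewrite natrM.
have m1 : (1 : R) < m%:R by rewrite ltr1n.
have Bern k : 1 + k%:R * ((m%:R - 1)^-1) <= (1 + (m%:R - 1)^-1) ^+ k :> R.
  have y0 : 0 <= (m%:R - 1)^-1 :> R by rewrite invr_ge0; lra.
  elim: k => [|k IH]; first by rewrite expr0 mul0r addr0.
  rewrite exprS -natr1; set y := (_ - 1)^-1 in IH y0 *.
  apply: le_trans (_ : _ <= (1 + y) * (1 + k%:R * y)) _.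
    rewrite -subr_ge0.
    have -> : (1 + y) * (1 + k%:R * y) - (1 + (k%:R + 1) * y) = k%:R * (y * y) by ring.
    by rewrite mulr_ge0 ?ler0n // mulr_ge0.
  by rewrite ler_wpM2l //; lra.
have e : 1 - m%:R^-1 = (1 + (m%:R - 1)^-1)^-1 :> R.
  field; apply/andP; split; apply/eqP => H; lra.
rewrite e exprVn lef_pV2 ?qualifE /= ?ltr0n //; last first.
  by rewrite exprn_gt0 // addr_gt0 ?ltr01 // invr_gt0; lra.
apply: le_trans (Bern m).
have : 1 <= m%:R / (m%:R - 1) :> R by rewrite ler_pdivlMr; lra.
lra.
Qed.

Lemma nohit_mult_drift_bound (A B : pred X) (f : X -> R) (a b : nat) :
  (forall C, A C -> ~~ B C -> forall i, A (stp i C)) ->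
  (forall C, 0 <= f C) ->
  (forall C, A C -> ~~ B C -> 2^-1 ^+ a <= f C) ->
  (forall C, A C -> ~~ B C -> f C <= 2 ^+ b) ->
  (forall C, A C -> ~~ B C ->
     \sum_i (if B (stp i C) then 0 else f (stp i C)) <= (n%:R - 1/2) * f C) ->
  forall C, A C -> nohit B (2 * n * (a + b + 3)) C <= 8^-1.
Proof.
move=> Acl f_ge0 f_ge f_le drift C AC; have [BC|BC] := boolP (B C).
  by rewrite nohit_in // invr_ge0.
have eps0 : 0 < 2^-1 ^+ a :> R by rewrite exprn_gt0 // invr_gt0.
apply: le_trans (nohit_mult_drift Acl f_ge0 eps0 f_ge drift _ AC BC) _.
set r := 1 - _ : R.
have r_ge0 : 0 <= r.
  have : (1 : R) <= n%:R by rewrite ler1n.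
  by move=> n1; rewrite subr_ge0 invf_le1; lra.
apply: le_trans (_ : _ <= 2 ^+ b * 2 ^+ a * (2^-1 ^+ (a + b + 3))) _.
  rewrite ler_pM ?exprn_ge0 //.
  - by rewrite divr_ge0 // ltW.
  - by rewrite exprVn invrK ler_pM2r ?exprn_gt0 // f_le.
  - rewrite exprM; apply: lerXn2r; rewrite ?qualifE /= ?exprn_ge0 ?invr_ge0 //.
    exact: half_pow.
rewrite !exprD !exprVn.
have h k : (2 : R) ^+ k != 0 by rewrite expf_neq0 // pnatr_eq0.
by have -> : 2 ^+ b * 2 ^+ a * ((2 ^+ a)^-1 * (2 ^+ b)^-1 * (2 ^+ 3)^-1) = 8^-1 :> R by field; rewrite !h.
Qed.

Lemma sum_nohit_add_drift (A B : pred X) (f : X -> R) :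
  (forall C, A C -> ~~ B C -> forall i, A (stp i C)) ->
  (forall C, A C -> 0 <= f C) ->
  (forall C, A C -> ~~ B C -> \sum_i f (stp i C) <= n%:R * (f C - 1)) ->
  forall m C, A C -> \sum_(t < m) nohit B t C <= f C.
Proof.
move=> Acl f_ge0 drift; elim=> [|m IH] C AC; first by rewrite big_ord0 f_ge0.
have [BC|BC] := boolP (B C).
  by rewrite big1 ?f_ge0 // => i _; rewrite nohit_in.
have n0 : nohit B (@ord0 m) C = 1 by rewrite /= (negbTE BC).
rewrite big_ord_recl n0.
under eq_bigr => t _ do rewrite lift0 nohitS (negbTE BC).
rewrite -mulr_suml exchange_big /=.
have : (\sum_i \sum_(t < m) nohit B t (stp i C)) / n%:R <= f C - 1; last by lra.
rewrite ler_pdivrMr // [leRHS]mulrC (le_trans _ (drift _ AC BC)) //.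
by apply: ler_sum => i _; apply: IH; apply: Acl.
Qed.

Lemma nohit_add_drift_bound (A B : pred X) (f : X -> R) (m : nat) :
  (forall C, A C -> ~~ B C -> forall i, A (stp i C)) ->
  (forall C, A C -> 0 <= f C) ->
  (forall C, A C -> ~~ B C -> \sum_i f (stp i C) <= n%:R * (f C - 1)) ->
  (forall C, A C -> 8 * f C <= m%:R) -> (0 < m)%N ->
  forall C, A C -> nohit B m C <= 8^-1.
Proof.
move=> Acl f_ge0 drift f_le m_gt0 C AC.
have S := sum_nohit_add_drift Acl f_ge0 drift m AC.
have : \sum_(t < m) nohit B m C <= f C.
  apply: le_trans S; apply: ler_sum => i _; apply: nohit_mono; exact: ltnW.
rewrite sumr_const card_ord -mulr_natl => H.
have m0 : 0 < m%:R :> R by rewrite ltr0n.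
rewrite -(ler_pM2l m0); have := f_le C AC; lra.
Qed.

Lemma nohit_iter (S : pred X) (T : nat) (q : R) : 0 <= q ->
  (forall C, nohit S T C <= q) -> forall k C, nohit S (k * T) C <= q ^+ k.
Proof.
move=> q_ge0 Sq; elim=> [|k IH] C; first by rewrite expr0 nohit_le1.
suff H s (x : R) : (forall C, nohit S s C <= x) -> 0 <= x ->
    forall t C, nohit S (t + s) C <= nohit S t C * x.
  rewrite mulSn exprS; apply: le_trans (H _ _ IH (exprn_ge0 _ q_ge0) _ _) _.
  by rewrite ler_wpM2r ?exprn_ge0.
move=> {}IH x_ge0; elim=> [|t IHt] {}C.
  rewrite add0n [nohit S 0 C]/=; case: ifP => [SC|_]; last by rewrite mul1r.
  by rewrite mul0r nohit_in.
rewrite addSn !nohitS; case: ifP => _; first by rewrite mul0r.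
by rewrite mulrAC ler_pM2r ?invr_gt0 // mulr_suml ler_sum.
Qed.

Lemma sum_nohit_restart (S : pred X) (T : nat) : (0 < T)%N ->
  (forall C, nohit S T C <= 3/4) -> forall m C, \sum_(t < m) nohit S t C <= 4 * T%:R.
Proof.
move=> T_gt0 Sq m C.
have q0 : 0 <= 3/4 :> R by lra.
have blk k : \sum_(t < k * T) nohit S t C <= 4 * T%:R * (1 - (3/4) ^+ k).
  elim: k => [|k IH]; first by rewrite mul0n big_ord0 expr0 subrr mulr0.
  rewrite mulSnr big_split_ord /= exprS.
  have : \sum_(i < T) nohit S (k * T + i) C <= \sum_(i < T) (3/4) ^+ k.
    apply: ler_sum => i _; apply: le_trans (nohit_iter q0 Sq k C).
    by apply: nohit_mono; rewrite leq_addr.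
  rewrite sumr_const card_ord -[_ *+ T]mulr_natl => H.
  by apply: le_trans (lerD IH H) _; set y := _ ^+ k; lra.
have le_m : (m <= m * T)%N by rewrite leq_pmulr.
apply: le_trans (_ : _ <= \sum_(t < m * T) nohit S t C) _.
  rewrite -(subnKC le_m) big_split_ord /= lerDl sumr_ge0 // => i _.
  exact: nohit_ge0.
apply: le_trans (blk m) _.
rewrite -subr_ge0.
have -> : 4 * T%:R - 4 * T%:R * (1 - (3/4) ^+ m) = 4 * T%:R * (3/4) ^+ m :> R by ring.
by rewrite mulr_ge0 ?exprn_ge0 // mulr_ge0 ?ler0n.
Qed.

Lemma exists_ordS t (P : pred nat) :
  [exists s : 'I_t.+1, P s] = P 0%N || [exists s : 'I_t, P s.+1].
Proof.
apply/existsP/orP => [[s Ps]|[P0|/existsP[s Ps]]].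
- case: (unliftP ord0 s) Ps => [j ->|->] Ps; last by left.
  by right; apply/existsP; exists j; rewrite lift0 in Ps.
- by exists ord0.
- by exists (lift ord0 s); rewrite lift0.
Qed.

Lemma card_nohit (S : pred X) t C :
  #|[pred g : t.-tuple 'I_n | ~~ [exists s : 'I_t.+1, S (run C g s)]]|%:R
    = (n ^ t)%:R * nohit S t C :> R.
Proof.
elim: t C => [|t IH] C.
  rewrite expn0 mul1r /=.
  transitivity (\sum_(g : 0.-tuple 'I_n) (~~ S C)%:R : R).
    rewrite -sum1_card natr_sum big_mkcond /=; apply: eq_bigr => g _.
    rewrite inE (@exists_ordS 0 (fun s => S (run C g s))) {1}/run take0 /=.
    case: existsP => [[[]]//|_]; rewrite orbF; by case: (S C).
  rewrite sumr_const card_tuple expn0 mulr1n; by case: (S C).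
rewrite nohitS.
case: ifP => SC.
  rewrite mulr0 eq_card0 // => g; rewrite inE /=; apply/negbTE/negPn.
  by rewrite (@exists_ordS t.+1 (fun s => S (run C g s))) {1}/run take0 /= SC.
pose h (p : 'I_n * t.-tuple 'I_n) := [tuple of p.1 :: p.2].
pose h' (g : t.+1.-tuple 'I_n) := (thead g, [tuple of behead g]).
have hK : cancel h h' by move=> [i g]; rewrite /h' /h theadE; congr (_, _); apply: val_inj.
have h'K : cancel h' h by move=> g; rewrite [RHS]tuple_eta; apply: val_inj.
rewrite -sum1_card natr_sum big_mkcond /=.
rewrite (reindex h) /=; last by exists h' => ? _; [apply: hK | apply: h'K].
set Sm := \sum_i nohit _ _ _.
have -> : (n ^ t.+1)%:R * (Sm / n%:R) = (n ^ t)%:R * Sm :> R.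
  by rewrite expnS natrM; field.
rewrite -(pair_big predT predT (fun i g => if h (i, g) \in _ then 1 else 0)) /=.
rewrite mulr_sumr; apply: eq_bigr => i _; rewrite -IH.
rewrite -sum1_card natr_sum [RHS]big_mkcond /=; apply: eq_bigr => g _.
rewrite !inE (@exists_ordS t.+1 (fun s => S (run C _ s))) {1}/run take0 /= SC /=.
by [].
Qed.

End Chain.

(** * Interactions on the ring *)

Section Interaction.
Variable N : nat.
Hypothesis N_gt0 : 0 < N.

Definition fire (l : agent) : nat := if ld l && sg l then 2 else bu l.
(* The [di] field of a leader may be arbitrary, but it is reset to 0 before it is read. *)
Definition ed (a : agent) : nat := if ld a then 0 else di a.
Definition newdi (l r : agent) : nat := if bu r == 0 then minn (ed l).+1 N else di r.
Definition creates (l r : agent) : bool := ~~ ld r && (newdi l r == N).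
Definition kills (l r : agent) : bool := [&& ld r, fire l == 2 & ~~ (sh r && ~~ sg r)].

Definition resp (l r : agent) : agent :=
  if ld r then
    Agent (~~ kills l r) (if sg r then 1 else bu r) (sh r && ~~ sg r) false 0
  else if creates l r then Agent true 2 true false 0
  else Agent false (if bu r == 0 then fire l else bu r) (sh r)
         (sg r && (fire l == 0)) (newdi l r).

Definition init (l r : agent) : agent :=
  Agent (ld l) 0 (ld l && sg l || sh l)
    [|| sg l && ~~ ld l, sg (resp l r) | ld (resp l r)] (ed l).

Lemma interactE l r : interact N l r = (init l r, resp l r).
Proof.
have N0 : (0 == N) = false by rewrite eq_sym -[N]prednK.
rewrite /interact /init /resp /creates /kills /newdi /fire /ed /set_di.
case: l => [[] [|b] s [] d]; case: r => [[] [|b2] [] [] d2] /=; rewrite ?N0 ?eqxx //=;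
  try case: (minn _ _ == N) => //=; try case: (d2 == N) => //=;
  try case: (b.+1 == 2) => //=; try case: s => //=; by rewrite ?N0.
Qed.

Lemma bu_resp l r : bu l <= 2 -> bu r <= 2 -> bu (resp l r) <= 2.
Proof.
move=> bl br; rewrite /resp /fire; case: ifP => _ /=; first by case: ifP.
by case: ifP => _ //=; case: ifP => _ //; case: ifP.
Qed.

Lemma di_resp l r : di r <= N -> di (resp l r) <= N.
Proof.
move=> dr; rewrite /resp /newdi; case: ifP => _ //=.
by case: ifP => _ //=; case: ifP => _ //; rewrite geq_minr.
Qed.

Lemma di_init l r : di l <= N -> di (init l r) <= N.
Proof. by rewrite /init /ed /=; case: ifP. Qed.

End Interaction.

Section Ring.
Variable n : nat.
Hypothesis n_gt1 : 1 < n.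
Implicit Types (w i : 'I_n) (a : 'I_n -> agent).

Definition pos w (j : nat) : 'I_n := iter j (@ordS n) w.

Lemma val_pos w j : pos w j = (w + j) %% n :> nat.
Proof.
elim: j => [|j IH]; first by rewrite addn0 modn_small.
by rewrite /pos iterS /= -/(pos w j) IH -addn1 modnDml addn1 addnS.
Qed.

Lemma posS w j : pos w j.+1 = ordS (pos w j). Proof. by []. Qed.
Lemma pos0 w : pos w 0 = w. Proof. by []. Qed.
Lemma posD w j k : pos w (j + k) = pos (pos w j) k.
Proof. by rewrite addnC /pos iterD. Qed.
Lemma posn w : pos w n = w.
Proof. by apply: val_inj; rewrite /= val_pos modnDr modn_small. Qed.

Lemma pos_inj w j k : j < n -> k < n -> pos w j = pos w k -> j = k.
Proof.
move=> jn kn /(congr1 val) /=; rewrite !val_pos.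
have := ltn_ord w; move=> wn H.
have [h1|h1] := ltnP (w + j) n; have [h2|h2] := ltnP (w + k) n; move: H.
- by rewrite !modn_small //; lia.
- rewrite modn_small // -(subnK h2) modnDr modn_small; lia.
- rewrite [RHS]modn_small // -(subnK h1) modnDr modn_small; lia.
- rewrite -(subnK h2) -(subnK h1) !modnDr !modn_small; lia.
Qed.

Lemma posP w i : exists2 j, j < n & i = pos w j.
Proof.
have n_gt0 : 0 < n by lia.
exists ((i + (n - w)) %% n); first by rewrite ltn_mod.
apply: val_inj; rewrite /= val_pos modnDmr.
have -> : w + (i + (n - w)) = i + n by have := ltn_ord w; lia.
by rewrite modnDr modn_small.
Qed.

Lemma ordS_injective : injective (@ordS n).
Proof. exact: can_inj (@ordSK n). Qed.

Lemma ordS_neq i : ordS i != i.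
Proof.
apply/eqP => H; have := @pos_inj i 1 0 n_gt1 (ltnW n_gt1); by rewrite /pos /= => /(_ H).
Qed.

End Ring.

Section Step.
Variables (N n : nat).
Hypothesis (n_gt1 : 1 < n) (leNn : n <= N).
Let N_gt0 : 0 < N. Proof. by lia. Qed.
Implicit Types (C : config N n) (i w u : 'I_n).

Definition cf C u : agent := decode (C u).

Lemma bu_cf C u : bu (cf C u) <= 2.
Proof. by rewrite /cf; case: (C u) => [[[[l b] s] g] d] /=; rewrite -ltnS. Qed.
Lemma di_cf C u : di (cf C u) <= N.
Proof. by rewrite /cf; case: (C u) => [[[[l b] s] g] d] /=; rewrite -ltnS. Qed.

Lemma encodeK (x : agent) : bu x <= 2 -> di x <= N -> decode (encode N x) = x.
Proof. by case: x => l b s g d /= hb hd; rewrite /= !inordK. Qed.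

Lemma cf_step_l C i : cf (step i C) i = init N (cf C i) (cf C (ordS i)).
Proof.
rewrite /cf /step ffunE eqxx /T interactE //; apply: encodeK => //.
by apply: di_init; apply: di_cf.
Qed.

Lemma cf_step_r C i : cf (step i C) (ordS i) = resp N (cf C i) (cf C (ordS i)).
Proof.
rewrite /cf /step ffunE (negbTE (ordS_neq n_gt1 i)) eqxx /T interactE //; apply: encodeK.
  by apply: bu_resp; apply: bu_cf.
by apply: di_resp; apply: di_cf.
Qed.

Lemma cf_step_o C i u : u <> i -> u <> ordS i -> cf (step i C) u = cf C u.
Proof. by move=> /eqP ui /eqP uj; rewrite /cf /step ffunE (negbTE ui) (negbTE uj). Qed.

Variant step_spec C i u : agent -> Type :=
 | StepL of u = i : step_spec C i u (init N (cf C i) (cf C (ordS i)))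
 | StepR of u = ordS i & u <> i : step_spec C i u (resp N (cf C i) (cf C (ordS i)))
 | StepO of u <> i & u <> ordS i : step_spec C i u (cf C u).

Lemma stepP C i u : step_spec C i u (cf (step i C) u).
Proof.
have [->|ui] := eqVneq u i; first by rewrite cf_step_l; constructor.
have [e|uj] := eqVneq u (ordS i).
  by rewrite e cf_step_r; constructor => //; rewrite -e; apply/eqP.
by rewrite cf_step_o; [constructor; apply/eqP | apply/eqP..].
Qed.

Section Zone.
Variable Q : nat -> agent -> bool.

(* [Q 0] describes the leader [w], and [Q j] the agent [j] places after it. *)
Definition zone C w k := forall j, j <= k -> Q j (cf C (pos w j)).

Definition inz C u := [exists w : 'I_n, [exists k : 'I_n, (u == pos w k) &&
    [forall j : 'I_n, (j <= k) ==> Q j (cf C (pos w j))]]].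

Lemma inzP C u : reflect (exists w k, [/\ k < n, u = pos w k & zone C w k]) (inz C u).
Proof.
apply: (iffP existsP) => [[w /existsP[k /andP[/eqP uk /forallP H]]]|[w [k [kn uk z]]]].
  exists w, k; split=> // j jk.
  by have := H (Ordinal (leq_ltn_trans jk (ltn_ord k))); rewrite /= jk.
exists w; apply/existsP; exists (Ordinal kn); rewrite uk eqxx /=.
by apply/forallP => j; apply/implyP => jk; apply: z.
Qed.

Lemma zone_step C i w k : k < n -> zone C w k ->
  (forall j, j.+1 < n -> let l := cf C (pos w j) in let r := cf C (pos w j.+1) in
     Q j l -> Q j.+1 r -> Q j (init N l r) && Q j.+1 (resp N l r)) ->
  (ordS i = w -> Q 0 (resp N (cf C i) (cf C w))) ->
  (i = pos w k -> Q k (init N (cf C i) (cf C (ordS i)))) ->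
  zone (step i C) w k.
Proof.
move=> kn z Hint Hinto Hfront j jk; case: stepP => [e|e e'|_ _]; last exact: z.
- case: (ltngtP j k) jk => // jk _; last first.
    by move: e; rewrite jk => e; apply: Hfront.
  rewrite -e -posS; suff /andP[] : Q j (init N (cf C (pos w j)) (cf C (pos w j.+1)))
     && Q j.+1 (resp N (cf C (pos w j)) (cf C (pos w j.+1))) by [].
  by apply: Hint; [lia | apply: z; lia | apply: z].
- case: j jk e e' => [|j] jk e e'.
    by rewrite -e; apply: Hinto.
  have ei : i = pos w j by apply: (@ordS_injective n); rewrite -e.
  rewrite -e ei.
  suff /andP[] : Q j (init N (cf C (pos w j)) (cf C (pos w j.+1)))
     && Q j.+1 (resp N (cf C (pos w j)) (cf C (pos w j.+1))) by [].
  by apply: Hint; [lia | apply: z; lia | apply: z].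
Qed.

Lemma zoneS C w k : zone C w k -> Q k.+1 (cf C (pos w k.+1)) -> zone C w k.+1.
Proof. by move=> z q j; rewrite leq_eqVlt => /orP[/eqP->//|jk]; apply: z. Qed.

Lemma zone_cat C w k w2 k2 : zone C w2 k2 -> pos w2 k2.+1 = w ->
  (forall j, j <= k -> Q (k2.+1 + j) (cf C (pos w j))) -> zone C w2 (k2.+1 + k).
Proof.
move=> z e H j jk; have [h|h] := leqP j k2; first exact: z.
by rewrite -(subnKC h) posD e; apply: H; lia.
Qed.

End Zone.

Definition Qok j (x : agent) := if j is 0 then ld x else ~~ ld x && (di x <= j).
Definition Qgood j (x : agent) := [&& Qok j x, ~~ sg x & (j == 0) ==> sh x].
Definition Qclean j (x : agent) := (ld x == (j == 0)) && ~~ sg x.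

Lemma Qok_no_create j l r : j.+1 < n -> Qok j l -> Qok j.+1 r -> newdi N l r <= j.+1.
Proof.
move=> jn; rewrite /newdi /ed; case: j jn => [|j] jn /=.
  by move=> -> /andP[_ dr]; case: ifP => // _; rewrite geq_min.
case/andP=> /negbTE-> dl /andP[_ dr]; case: ifP => // _.
by rewrite geq_min ltnS dl.
Qed.

Lemma creates_lt l r : newdi N l r < N -> creates N l r = false.
Proof. by move=> h; rewrite /creates ltn_eqF ?andbF. Qed.

Lemma Qok_int j l r : j.+1 < n -> Qok j l -> Qok j.+1 r ->
  Qok j (init N l r) && Qok j.+1 (resp N l r).
Proof.
move=> jn ql qr; have h := Qok_no_create jn ql qr.
have nc : creates N l r = false by apply: creates_lt; lia.
case/andP: (qr) => /negbTE lr dr; rewrite /resp lr nc /= h andbT.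
by case: j jn ql {h qr dr} => [|j] jn /=; rewrite /ed //; case/andP=> /negbTE-> ->.
Qed.

Lemma Qgood_int j l r : j.+1 < n -> Qgood j l -> Qgood j.+1 r ->
  Qgood j (init N l r) && Qgood j.+1 (resp N l r).
Proof.
move=> jn /and3P[ql sl s0] /and3P[qr sr _].
have /andP[q1 q2] := Qok_int jn ql qr.
have h := Qok_no_create jn ql qr.
have nc : creates N l r = false by apply: creates_lt; lia.
rewrite /Qgood q1 q2; case/andP: (qr) => /negbTE lr dr.
rewrite /init /resp lr nc /= (negbTE sl) (negbTE sr) /= andbF /= andbT.
by case: eqP s0 => //= _ ->.
Qed.

Lemma Qclean_int j l r : j.+1 < n -> Qclean j l -> Qclean j.+1 r -> newdi N l r < N ->
  Qclean j (init N l r) && Qclean j.+1 (resp N l r).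
Proof.
move=> jn /andP[/eqP ql sl] /andP[/eqP qr sr] h.
rewrite /Qclean /init /resp qr /= creates_lt //= ql (negbTE sl) (negbTE sr) /=.
by rewrite eqxx.
Qed.

Lemma Qgood_into l r : Qgood 0 r -> Qgood 0 (resp N l r).
Proof.
by case/and3P=> /= lr sr hr; rewrite /Qgood /resp /kills lr /= (negbTE sr) hr /= andbF.
Qed.

End Step.

(** * Invariants *)

Section Phases.
Variables (N n : nat).
Hypothesis (n_gt1 : 1 < n) (leNn : n <= N).
Implicit Types (C : config N n) (i w u : 'I_n).
Let n_gt0 : 0 < n. Proof. by lia. Qed.

Definition ok C u := inz Qok C u.
Definition good C u := inz Qgood C u.
Definition clean C u := inz Qclean C u.
Definition has_leader C := [exists u, ld (cf C u)].
Definition live_good C := [forall u, (bu (cf C u) == 2) ==> good C u].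
Definition led C := live_good C && has_leader C.
Definition calm C := led C && [forall u, ok C u].
Definition tidy C := calm C && [forall u, (0 < bu (cf C u)) ==> clean C u].
Definition leaders C := [set u | ld (cf C u)].

Lemma Qgood_ok j x : Qgood j x -> Qok j x. Proof. by case/and3P. Qed.
Lemma Qgood_clean j x : Qgood j x -> Qclean j x.
Proof.
by case/and3P=> q s _; rewrite /Qclean s andbT; case: j q => [|j] /=; [move=> -> | case/andP=> /negbTE->].
Qed.

Lemma good_step C i u : good C u -> u <> i -> good (step i C) u.
Proof.
move=> /inzP[w [k [kn uk z]]] ui; apply/inzP; exists w, k; split=> //.
apply: zone_step => //.
- by move=> j jn l r; apply: (Qgood_int n_gt1 leNn).
- by move=> _; apply: Qgood_into; apply: (z 0).
- by move=> e; case: ui; rewrite uk e.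
Qed.

Lemma Qgood_front k l r : Qgood k l -> ld (resp N l r) = false -> sg (resp N l r) = false ->
  Qgood k (init N l r).
Proof.
case/and3P=> ql sl s0 lr sr; rewrite /Qgood /= lr sr (negbTE sl) /=.
apply/andP; split; last by apply/implyP=> /(implyP s0) ->; rewrite orbT.
by case: k ql {s0} => [|k] //=; rewrite /ed; case/andP=> /negbTE->.
Qed.

Lemma killer_zone C i : live_good C -> kills (cf C i) (cf C (ordS i)) ->
  exists w k, [/\ k < n, i = pos w k, w <> ordS i, zone Qok (step i C) w k
    & zone Qclean (step i C) w k].
Proof.
move=> /forallP lg kl.
have /and3P[lr f2 shr] := kl.
have lr' : ld (resp N (cf C i) (cf C (ordS i))) = false by rewrite /resp lr kl.
have sr' : sg (resp N (cf C i) (cf C (ordS i))) = false by rewrite /resp lr.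
have [/andP[ll sl]|nf] := boolP (ld (cf C i) && sg (cf C i)).
  exists i, 0; split => //; first by apply/eqP; rewrite eq_sym ordS_neq.
  - by case=> // _; rewrite pos0 cf_step_l.
  - case=> // _; rewrite pos0 cf_step_l //.
    by rewrite /Qclean /= lr' sr' ll /= andbF.
have b2 : bu (cf C i) == 2 by move: f2; rewrite /fire (negbTE nf).
have /inzP[w [k [kn ik z]]] := implyP (lg i) b2.
have wi : w <> ordS i.
  by move=> e; have := z 0 isT; rewrite pos0 e => /and3P[_ s0 /= h0]; rewrite s0 h0 in shr.
have z' : zone Qgood (step i C) w k.
  apply: zone_step => //.
  - by move=> j jn l r; apply: (Qgood_int n_gt1 leNn).
  - by move=> e; case: wi.
  - by move=> _; apply: Qgood_front => //; rewrite ik; apply: z.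
exists w, k; split=> // j jk; [apply: Qgood_ok | apply: Qgood_clean]; exact: z'.
Qed.

Section Merge.
Variable Q : nat -> agent -> bool.
Hypothesis Qmono : forall j j' x, 0 < j -> j <= j' -> Q j x -> Q j' x.
Hypothesis Qdead : forall j b s, Q j.+1 (Agent false b s false 0).
Hypothesis Qld : forall j x, Q j x -> ld x = (j == 0).

Lemma merge_zone C i k w2 k2 : kills (cf C i) (cf C (ordS i)) ->
  k2 < n -> i = pos w2 k2 -> w2 <> ordS i -> zone Q (step i C) w2 k2 -> k < n ->
  (forall j, 0 < j -> j <= k -> Q j (cf C (pos (ordS i) j))) ->
  inz Q (step i C) (pos (ordS i) k).
Proof.
move=> kl k2n ik wi z kn H; set w := ordS i in wi H *.
have lw2 : ld (cf C w2).
  have := Qld (z 0 isT); rewrite pos0 /=.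
  by case: (stepP n_gt1 leNn) => [->|/wi|] //.
have lt : k2.+1 + k < n.
  rewrite ltnNge; apply/negP => ge.
  have e : w2 = pos w (n - k2.+1).
    by rewrite /w ik -posS -posD subnKC // posn.
  have := posn w2; case E : (n - k2.+1) e => [|m] e; first by move: e.
  have /Qld := H m.+1 isT ltac:(lia).
  by rewrite -e lw2.
apply/inzP; exists w2, (k2.+1 + k); split=> //; first by rewrite posD posS -ik.
have e0 : pos w2 k2.+1 = w by rewrite posS -ik.
apply: (zone_cat n_gt1 leNn z e0).
case=> [|j] jk.
  rewrite pos0 addn0 cf_step_r // /resp; case/and3P: (kl) => -> _ _.
  by rewrite kl; apply: Qdead.
have jn : j.+1 < n by lia.
rewrite cf_step_o.
- by apply: Qmono (H j.+1 isT jk) => //; lia.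
- move=> e; have e2 : pos w j.+2 = pos w n by rewrite posS e posn.
  have e3 : n = j.+2.
    case: (ltngtP j.+2 n) => // h; last by lia.
    have := @pos_inj n n_gt1 w j.+2 0 h n_gt0; by rewrite e2 posn pos0 => /(_ erefl).
  have [m mn em] := posP n_gt1 w w2.
  case: m mn em => [|m] mn em; first by case: wi.
  have /Qld := H m.+1 isT ltac:(lia).
  by rewrite -em lw2.
- move=> e; have := @pos_inj n n_gt1 w j.+1 0 jn n_gt0; by rewrite pos0 => /(_ e).
Qed.

End Merge.

Lemma Qok_mono j j' x : 0 < j -> j <= j' -> Qok j x -> Qok j' x.
Proof. by case: j j' => [|j] [|j'] // _ jj /andP[/= -> d]; apply: leq_trans d jj. Qed.
Lemma Qok_ld j x : Qok j x -> ld x = (j == 0).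
Proof. by case: j => [|j] //= /andP[/negbTE]. Qed.
Lemma Qclean_mono j j' x : 0 < j -> j <= j' -> Qclean j x -> Qclean j' x.
Proof. by case: j j' => [|j] [|j']. Qed.
Lemma Qclean_ld j x : Qclean j x -> ld x = (j == 0).
Proof. by case/andP=> /eqP. Qed.

Lemma ok_step C i u : live_good C -> ok C u -> ok (step i C) u.
Proof.
move=> lg /inzP[w [k [kn uk z]]].
have [/andP[/eqP e kl]|nk] := boolP ((ordS i == w) && kills (cf C i) (cf C (ordS i))).
  have [w2 [k2 [k2n ik wi z2 _]]] := killer_zone lg kl.
  rewrite uk -e; apply: merge_zone kl k2n ik wi z2 kn _ => //.
  - exact: Qok_mono.
  - exact: Qok_ld.
  - by move=> j j0 jk; rewrite e; apply: z.
apply/inzP; exists w, k; split=> //; apply: zone_step => //.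
- by move=> j jn l r; apply: (Qok_int n_gt1 leNn).
- move=> e; move: nk; rewrite e eqxx /= => nk.
  by have /= lw := z 0 isT; rewrite /resp lw /=.
- move=> e; have := z k (leqnn k); rewrite -e; case: (k) => [|k'] //= /andP[h1 h2].
  by rewrite h1 /ed (negbTE h1).
Qed.

Lemma ok_leader C u : ld (cf C u) -> ok C u.
Proof. by move=> lu; apply/inzP; exists u, 0; split=> // -[|j]. Qed.

Lemma ok_extend C i : live_good C -> ok C i -> ~~ ld (cf C (ordS i)) -> bu (cf C (ordS i)) = 0 ->
  ok (step i C) (ordS i).
Proof.
move=> lg oi; have := oi => /inzP[w [k [kn ik z]]] lr b0.
have lw : ld (cf C w) := z 0 isT.
have kn1 : k.+1 < n.
  case: (ltngtP k.+1 n) => // h; first by lia.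
  by move: lr; rewrite ik -posS h posn lw.
have z' : zone Qok (step i C) w k.
  apply: zone_step => //.
  - by move=> j jn l r; apply: (Qok_int n_gt1 leNn).
  - by move=> e; move: lr; rewrite e lw.
  - move=> _; have := z k (leqnn k); rewrite -ik; case: (k) => [|k'] //= /andP[h1 h2].
    by rewrite h1 /ed (negbTE h1).
apply/inzP; exists w, k.+1; split=> //; first by rewrite posS -ik.
apply: zoneS => //; rewrite posS -ik cf_step_r // /resp (negbTE lr).
have h : newdi N (cf C i) (cf C (ordS i)) <= k.+1.
  rewrite /newdi b0 eqxx geq_min; apply/orP; left.
  have := z k (leqnn k); rewrite -ik /ed; case: (k) => [|k'] /=; first by move=> ->.
  by case/andP=> /negbTE->.
by rewrite creates_lt //=; lia.
Qed.

Lemma live_step C i u : bu (cf (step i C) u) = 2 ->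
  good (step i C) u \/
  (u <> i /\ (bu (cf C u) = 2 /\ ~~ good C u) /\ ed (cf C u) <= ed (cf (step i C) u)) \/
  (u = ordS i /\ (bu (cf C i) = 2 /\ ~~ good C i) /\ ed (cf C i) < ed (cf (step i C) u)).
Proof.
case: (stepP n_gt1 leNn) => // [e ui|ui uj]; last first.
  move=> b2; have [gu|gu] := boolP (good C u); last by right; left.
  by left; apply: good_step.
rewrite {u}e in ui *; set l := cf C i; set r := cf C (ordS i).
have gr0 : good C (ordS i) -> good (step i C) (ordS i) by move=> g; apply: good_step.
rewrite {1}/resp; case: ifP => lr.
  move=> /=; case: ifP => sr // b2.
  have [gu|gu] := boolP (good C (ordS i)); first by left; apply: gr0.
  right; left; split=> //; split=> //; by rewrite /ed lr.
case: ifP => cr /=.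
  move=> _; left; apply/inzP; exists (ordS i), 0; split=> //.
  by case=> // _; rewrite pos0 cf_step_r // /resp lr cr.
case: eqP => [b0 f2|b0 b2]; last first.
  have [gu|gu] := boolP (good C (ordS i)); first by left; apply: gr0.
  right; left; split=> //; split=> //.
  by rewrite /ed lr /resp lr cr /= /newdi (negbTE (introN eqP b0)).
have rE : resp N l r = Agent false 2 (sh r) false (ed l).+1.
  rewrite /resp lr cr b0 eqxx f2 andbF /newdi b0 eqxx; congr Agent.
  move: cr; rewrite /creates lr /= /newdi b0 eqxx => /eqP; lia.
have [/andP[ll sl]|nf] := boolP (ld l && sg l).
  left; apply/inzP; exists i, 1; split=> //.
  case=> [|[|j]] // _.
    by rewrite pos0 cf_step_l // -/l -/r /Qgood /= rE /= ll sl.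
  by rewrite posS pos0 cf_step_r // -/l -/r rE /ed ll.
have bl : bu l = 2 by move: f2; rewrite /fire (negbTE nf).
have [gi|gi] := boolP (good C i); last first.
  by right; right; split=> //; split=> //; rewrite rE.
left; have /inzP[w [k [kn ik z]]] := gi.
have kn1 : k.+1 < n.
  case: (ltngtP k.+1 n) => // h; first by lia.
  by move: lr; rewrite /r ik -posS h posn => /negP[]; case/and3P: (z 0 isT).
have z' : zone Qgood (step i C) w k.
  apply: zone_step => //.
  - by move=> j jn ? ?; apply: (Qgood_int n_gt1 leNn).
  - by move=> _; apply: Qgood_into; apply: (z 0).
  - by move=> _; apply: Qgood_front; rewrite -/l -/r ?rE //; rewrite /l ik; apply: z.
apply/inzP; exists w, k.+1; split=> //; first by rewrite posS -ik.
apply: zoneS => //; rewrite posS -ik cf_step_r // -/l -/r rE /Qgood /= andbT.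
have := z k (leqnn k); rewrite -ik -/l => /and3P[+ _ _]; rewrite /ed.
by case: (k) => [|k'] /=; [move=> -> | case/andP=> /negbTE->].
Qed.

Lemma live_good_step C i : live_good C -> live_good (step i C).
Proof.
move=> lg; apply/forallP => u; apply/implyP => /eqP b2.
case: (live_step b2) => [//|[[_ [[b g] _]]|[_ [[b g] _]]]].
  by rewrite (implyP (forallP lg u)) ?b in g.
by rewrite (implyP (forallP lg i)) ?b in g.
Qed.

Lemma leader_step C i : live_good C -> has_leader C -> has_leader (step i C).
Proof.
move=> lg /existsP[u lu].
have [kl|nk] := boolP (kills (cf C i) (cf C (ordS i))).
  have [w [k [kn ik wi z _]]] := killer_zone lg kl.
  by apply/existsP; exists w; have := z 0 isT; rewrite pos0.
apply/existsP; exists u; case: (stepP n_gt1 leNn) => //.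
  by move=> e; rewrite /= -e.
by move=> e _; rewrite /resp -e lu /= e.
Qed.

Lemma led_step C i : led C -> led (step i C).
Proof. by case/andP=> lg hl; rewrite /led live_good_step ?leader_step. Qed.

Lemma calm_step C i : calm C -> calm (step i C).
Proof.
case/andP=> ldC /forallP o; rewrite /calm led_step //=.
by apply/forallP=> u; apply: ok_step (o u); case/andP: ldC.
Qed.

Lemma calm_newdi C i : calm C -> ~~ ld (cf C (ordS i)) ->
  newdi N (cf C i) (cf C (ordS i)) < N.
Proof.
case/andP=> _ /forallP o lr.
have := o (ordS i) => /inzP[w [k [kn ek z]]].
case: k kn ek z => [|k] kn ek z; first by move: lr; rewrite ek; have /= -> := z 0 isT.
have ei : i = pos w k by apply: (@ordS_injective n); rewrite ek.
have := @Qok_no_create N n k (cf C i) (cf C (ordS i)) kn.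
rewrite ek ei => /(_ (z k (leqnSn k)) (z k.+1 (leqnn _))).
by rewrite -ek -ei; lia.
Qed.

Lemma clean_step C i u : calm C -> clean C u -> u <> i -> clean (step i C) u.
Proof.
move=> cC; have lg : live_good C by case/andP: cC => /andP[].
move=> /inzP[w [k [kn uk z]]] ui.
have [/andP[/eqP e kl]|nk] := boolP ((ordS i == w) && kills (cf C i) (cf C (ordS i))).
  have [w2 [k2 [k2n ik wi _ z2]]] := killer_zone lg kl.
  rewrite uk -e; apply: merge_zone kl k2n ik wi z2 kn _ => //.
  - exact: Qclean_mono.
  - exact: Qclean_ld.
  - by move=> j j0 jk; rewrite e; apply: z.
apply/inzP; exists w, k; split=> //; apply: zone_step => //.
- move=> j jn l r ql qr; apply: (@Qclean_int N n) => //.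
  by rewrite /l /r posS; apply: calm_newdi => //; rewrite -posS (Qclean_ld qr).
- move=> e; move: nk; rewrite e eqxx /= => nk.
  by have lw := Qclean_ld (z 0 isT); rewrite pos0 /= in lw; rewrite /resp lw /Qclean /= nk.
- by move=> e; case: ui; rewrite uk e.
Qed.

Lemma dirty_step C i u : calm C -> 0 < bu (cf (step i C) u) ->
  clean (step i C) u \/
  (u <> i /\ (0 < bu (cf C u) /\ ~~ clean C u) /\ ed (cf C u) <= ed (cf (step i C) u)) \/
  (u = ordS i /\ (0 < bu (cf C i) /\ ~~ clean C i) /\ ed (cf C i) < ed (cf (step i C) u)).
Proof.
move=> cC; have lg : live_good C by case/andP: cC => /andP[].
case: (stepP n_gt1 leNn) => // [e ui|ui uj]; last first.
  move=> b2; have [gu|gu] := boolP (clean C u); last by right; left.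
  by left; apply: clean_step.
rewrite {u}e in ui *; set l := cf C i; set r := cf C (ordS i).
have gr0 : clean C (ordS i) -> clean (step i C) (ordS i) by move=> g; apply: clean_step.
have [lr _|lr] := boolP (ld r).
  left; have [kl|nk] := boolP (kills l r).
    have [w2 [k2 [k2n ik wi _ z2]]] := killer_zone lg kl.
    apply: (@merge_zone Qclean Qclean_mono _ Qclean_ld C i 0 w2 k2) => //.
    by case.
  apply/inzP; exists (ordS i), 0; split=> // -[|//] _.
  by rewrite pos0 cf_step_r // -/l -/r /resp lr /Qclean /= nk.
have cr : creates N l r = false by apply: creates_lt; apply: calm_newdi.
have nd : newdi N l r < N by apply: calm_newdi.
rewrite {1}/resp (negbTE lr) cr /=.
case: eqP => [b0 f2|b0 b2]; last first.
  have [gu|gu] := boolP (clean C (ordS i)); first by left; apply: gr0.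
  right; left; split=> //; split; first by split=> //; rewrite lt0n; apply/eqP.
  by rewrite /ed -/r (negbTE lr) /resp (negbTE lr) cr /= /newdi (negbTE (introN eqP b0)).
have rE : resp N l r = Agent false (fire l) (sh r) false (ed l).+1.
  rewrite /resp (negbTE lr) cr b0 eqxx /newdi b0 eqxx; congr Agent.
    by rewrite eqn0Ngt f2 andbF.
  by move: nd; rewrite /newdi b0 eqxx; lia.
have [/andP[ll sl]|nf] := boolP (ld l && sg l).
  left; apply/inzP; exists i, 1; split=> //.
  case=> [|[|j]] // _.
    by rewrite pos0 cf_step_l // -/l -/r /Qclean /= rE /= ll sl.
  by rewrite posS pos0 cf_step_r // -/l -/r rE /ed ll.
have bl : 0 < bu l by move: f2; rewrite /fire (negbTE nf).
have [gi|gi] := boolP (clean C i); last first.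
  by right; right; split=> //; split=> //; rewrite rE.
left; have /inzP[w [k [kn ik z]]] := gi.
have kn1 : k.+1 < n.
  case: (ltngtP k.+1 n) => // h; first by lia.
  by move: lr; rewrite /r ik -posS h posn => /negP[]; have := Qclean_ld (z 0 isT).
have z' : zone Qclean (step i C) w k.
  apply: zone_step => //.
  - move=> j jn l' r' ql qr; apply: (@Qclean_int N n) => //.
    by rewrite /l' /r' posS; apply: calm_newdi => //; rewrite -posS (Qclean_ld qr).
  - by move=> e; move: lr; rewrite /r e => /negP[]; have := Qclean_ld (z 0 isT).
  - move=> _; have := z k (leqnn k); rewrite -ik -/l -/r /Qclean /= rE /= => /andP[-> /negbTE->].
    by [].
apply/inzP; exists w, k.+1; split=> //; first by rewrite posS -ik.
by apply: zoneS => //; rewrite posS -ik cf_step_r // -/l -/r rE.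
Qed.

Lemma tidy_step C i : tidy C -> tidy (step i C).
Proof.
case/andP=> cC /forallP h; rewrite /tidy calm_step //=.
apply/forallP => u; apply/implyP => b2.
case: (dirty_step cC b2) => [//|[[_ [[b g] _]]|[_ [[b g] _]]]].
  by rewrite (implyP (h u)) ?b in g.
by rewrite (implyP (h i)) ?b in g.
Qed.

Lemma calm_leaders_step C i : calm C -> leaders (step i C) \subset leaders C.
Proof.
move=> cC; apply/subsetP => u; rewrite !inE; case: (stepP n_gt1 leNn) => //.
  by move=> ->.
move=> -> _; have [//|lr] := boolP (ld (cf C (ordS i))).
by rewrite /resp (negbTE lr) creates_lt //; apply: calm_newdi.
Qed.

Lemma safe_calm C : calm C -> #|leaders C| = 1 -> safe C.
Proof.
move=> cC c1; apply/andP; split; first by apply/eqP.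
apply/forallP => C'; apply/implyP => /connectP[p pp ->].
suff [_ e] : calm (last C p) /\ leaders (last C p) = leaders C.
  by apply/forallP=> u; have := congr1 (fun A : {set 'I_n} => u \in A) e; rewrite !inE => /eqP.
elim: p C cC c1 pp => [|D p IH] C cC c1 //= /andP[/existsP[i /eqP e] pp].
have cD : calm D by rewrite e calm_step.
have eL : leaders D = leaders C.
  apply/eqP; rewrite eqEcard c1 e calm_leaders_step //= -e.
  have /andP[/andP[_ /existsP[u lu]] _] := cD.
  by rewrite card_gt0; apply/set0Pn; exists u; rewrite inE.
have [] := IH D cD _ pp; first by rewrite eL.
by rewrite eL.
Qed.

End Phases.

(** * Reaching a tidy configuration *)

Section PhaseBounds.
Variables (R : realFieldType) (N n : nat).
Hypothesis (n_gt1 : (1 < n)%N) (leNn : (n <= N)%N).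
Implicit Types (C : config N n) (i w u : 'I_n).
Let n_gt0 : (0 < n)%N. Proof. by lia. Qed.
Local Open Scope ring_scope.
Local Notation stepc := (@step N n).
Implicit Types (bad : config N n -> pred 'I_n).

Definition weight C u : R := 2^-1 ^+ ed (cf C u).
Definition pot (bad : config N n -> pred 'I_n) C : R := \sum_(u | bad C u) weight C u.

Lemma weight_ge0 C u : 0 <= weight C u. Proof. by rewrite exprn_ge0 // invr_ge0. Qed.

Lemma half_le (a b : nat) : (a <= b)%N -> 2^-1 ^+ b <= 2^-1 ^+ a :> R.
Proof. by move=> ab; rewrite ler_wiXn2l // ?invr_ge0 // invf_le1 ?ler1n. Qed.

Lemma weight_ge C u : 2^-1 ^+ N <= weight C u.
Proof. by apply: half_le; rewrite /ed; case: ifP => // _; apply: di_cf. Qed.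

Lemma weight_le1 C u : weight C u <= 1.
Proof. exact: (half_le (leq0n _)). Qed.

Lemma natr_le_pow2 k : k%:R <= 2 ^+ k :> R.
Proof. by rewrite -natrX ler_nat ltnW // ltn_expl. Qed.

Lemma pot_ge0 bad C : 0 <= pot bad C.
Proof. by rewrite sumr_ge0 // => u _; apply: weight_ge0. Qed.

Lemma pot_ge bad C u : bad C u -> 2^-1 ^+ N <= pot bad C.
Proof.
move=> bu; rewrite /pot (bigD1 u) //=; apply: le_trans (weight_ge C u) _.
by rewrite lerDl sumr_ge0 // => v _; apply: weight_ge0.
Qed.

Lemma pot_le bad C : pot bad C <= 2 ^+ N.
Proof.
apply: le_trans (_ : _ <= \sum_(u : 'I_n) 1) _.
  rewrite /pot big_mkcond; apply: ler_sum => u _.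
  by case: ifP => // _; apply: weight_le1.
rewrite sumr_const card_ord; apply: le_trans (natr_le_pow2 n) _.
by rewrite ler_weXn2l // ler1n.
Qed.

Lemma sum_ordS (F : 'I_n -> R) : \sum_i F (ordS i) = \sum_i F i.
Proof.
by rewrite [RHS](reindex (@ordS n)) //; exists (@ord_pred n) => i _; rewrite ?ordSK ?ord_predK.
Qed.

Lemma pot_drift bad C :
  (forall i u, bad (step i C) u ->
     (u <> i /\ bad C u /\ (ed (cf C u) <= ed (cf (step i C) u))%N) \/
     (u = ordS i /\ bad C i /\ (ed (cf C i) < ed (cf (step i C) u))%N)) ->
  \sum_i pot bad (step i C) <= (n%:R - 1/2) * pot bad C.
Proof.
move=> H; pose x u : R := if bad C u then weight C u else 0.
have x_ge0 u : 0 <= x u by rewrite /x; case: ifP => // _; apply: weight_ge0.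
have potE : pot bad C = \sum_u x u by rewrite /pot big_mkcond.
have B i : pot bad (step i C) <= pot bad C - x i / 2.
  rewrite {1}/pot big_mkcond potE (bigD1 i) //= [in leRHS](bigD1 i) //=.
  have -> : bad (step i C) i = false.
    apply/negP => /H [[]//|[e _]].
    by have := ordS_neq n_gt1 i; rewrite -e eqxx.
  have ii := ordS_neq n_gt1 i.
  rewrite add0r (bigD1 (ordS i)) //= [in leRHS](bigD1 (ordS i)) //=.
  set s1 := \sum_(i0 | _) _; set s2 := \sum_(i0 | _) _.
  have s12 : s1 <= s2.
    apply: ler_sum => u /andP[ui us]; case: ifP => // /H[[_ [bu e]]|[e _]].
      by rewrite /x bu; apply: half_le.
    by rewrite e eqxx in us.
  have : (if bad (step i C) (ordS i) then weight (step i C) (ordS i) else 0) <= x (ordS i) + x i / 2.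
    case: ifP => [/H[[_ [bu e]]|[_ [bu e]]]|_]; last by rewrite addr_ge0 // divr_ge0.
      rewrite {1}/x bu; apply: le_trans (half_le e) _.
      by rewrite lerDl divr_ge0.
    rewrite [x i]/x bu; apply: le_trans (half_le e) _.
    rewrite exprS mulrC -/(weight C i); have := x_ge0 (ordS i); lra.
  lra.
apply: le_trans (_ : _ <= \sum_i (pot bad C - x i / 2)) _.
  by apply: ler_sum => i _.
rewrite big_split /= sumrN -mulr_suml -potE sumr_const card_ord -mulr_natl.
by rewrite le_eqVlt; apply/orP; left; apply/eqP; field.
Qed.

Lemma sum_if0_le (B : pred (config N n)) (f : config N n -> R) C :
  (forall C, 0 <= f C) ->
  \sum_i (if B (step i C) then 0 else f (step i C)) <= \sum_i f (step i C).
Proof. by move=> f0; apply: ler_sum => i _; case: ifP. Qed.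

Lemma bad_phase (A B : pred (config N n)) bad :
  (forall C, A C -> forall i, A (step i C)) ->
  (forall C, A C -> ~~ B C -> exists u, bad C u) ->
  (forall C, A C -> ~~ B C -> \sum_i pot bad (step i C) <= (n%:R - 1/2) * pot bad C) ->
  forall C, A C -> nohit R stepc B (2 * n * (N + N + 3)) C <= 8^-1.
Proof.
move=> Acl exb drift; apply: (@nohit_mult_drift_bound R _ _ _ n_gt0 A B (pot bad)).
- by move=> C hA _; apply: Acl.
- exact: pot_ge0.
- by move=> C hA hB; have [u hb] := exb C hA hB; apply: pot_ge hb.
- by move=> C _ _; apply: pot_le.
- move=> C hA hB; apply: le_trans (drift C hA hB).
  by apply: sum_if0_le; apply: pot_ge0.
Qed.

Lemma phase_live C : nohit R stepc (@live_good N n) (2 * n * (N + N + 3)) C <= 8^-1.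
Proof.
pose bad (C : config N n) u := (bu (cf C u) == 2) && ~~ good C u.
apply: (@bad_phase predT _ bad) => // {}C _.
  by case/forallPn=> u; rewrite negb_imply => bu; exists u.
move=> _; apply: pot_drift => i u /andP[/eqP b2 g].
case: (live_step n_gt1 leNn b2) => [g'|[[h1 [[h2 h3] h4]]|[h1 [[h2 h3] h4]]]].
- by rewrite g' in g.
- by left; rewrite /bad h2 h3.
- by right; rewrite /bad h2 h3.
Qed.

Lemma phase_tidy C : calm C -> nohit R stepc (@tidy N n) (2 * n * (N + N + 3)) C <= 8^-1.
Proof.
pose bad (C : config N n) u := (0 < bu (cf C u))%N && ~~ clean C u.
apply: (@bad_phase _ _ bad) => {C}.
- by move=> C cC i; apply: calm_step.
- move=> C cC; rewrite /tidy cC /= => /forallPn[u]; rewrite negb_imply => bu.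
  by exists u.
- move=> C cC _; apply: pot_drift => i u /andP[b2 g].
  case: (dirty_step n_gt1 leNn cC b2) => [g'|[[h1 [[h2 h3] h4]]|[h1 [[h2 h3] h4]]]].
  + by rewrite g' in g.
  + by left; rewrite /bad h2 h3.
  + by right; rewrite /bad h2 h3.
Qed.

Definition no_bullet C := [forall v, bu (cf C v) == 0].

Lemma leaderless_step C i : ~~ has_leader C -> ~~ has_leader (step i C) ->
  resp N (cf C i) (cf C (ordS i)) =
  Agent false (if bu (cf C (ordS i)) == 0 then bu (cf C i) else bu (cf C (ordS i)))
    (sh (cf C (ordS i))) (sg (cf C (ordS i)) && (bu (cf C i) == 0))
    (if bu (cf C (ordS i)) == 0 then (di (cf C i)).+1 else di (cf C (ordS i))).
Proof.
move=> /existsPn nl /existsPn nl'; have := nl' (ordS i); rewrite cf_step_r //.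
rewrite /resp (negbTE (nl _)); case: ifP => // cr _.
move: cr; rewrite /creates /fire /newdi /ed !(negbTE (nl _)) /= => /eqP cr.
by congr Agent; move: cr; case: ifP => // _; lia.
Qed.

Lemma phase_leader C : live_good C -> nohit R stepc (@led N n) (2 * n * (N + N + 3)) C <= 8^-1.
Proof.
pose bad (C : config N n) u := ~~ has_leader C && ((0 < bu (cf C u))%N || no_bullet C).
apply: (@bad_phase _ _ bad) => {C}.
- by move=> C lg i; apply: live_good_step.
- move=> C lg; rewrite /led lg /= => nl; rewrite /bad nl /=.
  have [nb|/forallPn[u b]] := boolP (no_bullet C); first by exists (Ordinal n_gt0); rewrite orbT.
  by exists u; rewrite lt0n b.
move=> C lg; rewrite /led lg /= => nl.
have nlE u : ld (cf C u) = false by apply/negbTE; apply: (existsPn nl).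
have [nb|nb] := boolP (no_bullet C); last first.
  apply: pot_drift => i u /andP[nl' b].
  have rE := leaderless_step nl nl'.
  have nb' : ~~ no_bullet (step i C).
    case/forallPn: nb => v bv; apply/forallPn.
    have [e|vi] := eqVneq v i.
      rewrite e in bv; exists (ordS i); rewrite cf_step_r // rE /=.
      by case: ifP => [//|->].
    exists v; case: (stepP n_gt1 leNn) => // [/eqP|e _]; first by rewrite (negbTE vi).
    by rewrite rE /= -e (negbTE bv).
  rewrite (negbTE nb') orbF in b.
  rewrite /bad nl /= (negbTE nb) !orbF.
  case: (stepP n_gt1 leNn) b => // [e ui|ui uj] b; last by left.
  rewrite rE /ed !nlE /= e; move: b; rewrite rE /=; case: eqP => [b0|b0] b.
    by right.
  by left; rewrite lt0n -e; split=> //; split=> //; apply/eqP; rewrite e.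
have b0 u : bu (cf C u) = 0%N by apply/eqP; apply: (forallP nb).
have potE : pot bad C = \sum_u weight C u.
  by apply: eq_bigl => u; rewrite /bad nl nb orbT.
have B i : pot bad (step i C) <= \sum_u weight C u - weight C (ordS i) + weight C i / 2.
  have [hl|nl'] := boolP (has_leader (step i C)).
    rewrite /pot big_pred0 => [|u]; last by rewrite /bad hl.
    rewrite (bigD1 (ordS i)) //=.
    have : 0 <= \sum_(u | u != ordS i) weight C u by rewrite sumr_ge0 // => u _; apply: weight_ge0.
    have := weight_ge0 C i; lra.
  have rE := leaderless_step nl nl'.
  apply: le_trans (_ : _ <= \sum_u weight (step i C) u) _.
    rewrite /pot big_mkcond; apply: ler_sum => u _; case: ifP => // _.
    exact: weight_ge0.
  rewrite (bigD1 (ordS i)) //= [in leRHS](bigD1 (ordS i)) //=.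
  have -> : weight (step i C) (ordS i) = weight C i / 2.
    by rewrite /weight cf_step_r // rE /ed nlE /= b0 eqxx exprS mulrC.
  set s1 := \sum_(_ | _) _; set s2 := \sum_(_ | _) _.
  have : s1 <= s2.
    apply: ler_sum => u us; rewrite /weight.
    case: (stepP n_gt1 leNn) => // [->|e]; last by rewrite e eqxx in us.
    by rewrite /ed /= nlE /ed nlE.
  lra.
apply: le_trans (_ : _ <= \sum_i (\sum_u weight C u - weight C (ordS i) + weight C i / 2)) _.
  by apply: ler_sum => i _.
rewrite !big_split /= sumrN -mulr_suml (sum_ordS (weight C)) -potE sumr_const card_ord -mulr_natl.
by rewrite le_eqVlt; apply/orP; left; apply/eqP; field.
Qed.

(* The second summand counts the bullets that block the update of [di] at the border of
   the region of correct distances. *)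
Definition lag C u : nat :=
  ((~~ ok C u).*2 + [&& ok C u, ~~ ok C (ordS u) & 0 < bu (cf C (ordS u))])%N.
Definition total_lag C : nat := (\sum_u lag C u)%N.

Lemma lag_le2 C u : (lag C u <= 2)%N.
Proof. by rewrite /lag; case: (ok C u) => //=; case: (_ && _). Qed.

Lemma lag_step C i u : live_good C -> (lag (step i C) u <= lag C u)%N.
Proof.
move=> lg; have [o|o] := boolP (ok C u); last first.
  by apply: leq_trans (lag_le2 _ _) _; rewrite /lag o.
rewrite /lag o (ok_step n_gt1 leNn) //= !add0n.
have [o2|o2] := boolP (ok C (ordS u)); first by rewrite (ok_step n_gt1 leNn).
case: (posnP (bu (cf C (ordS u)))) => [b0|b0]; last by rewrite /=; case: (_ && _).
have lr : ~~ ld (cf C (ordS u)) by apply: contra o2; apply: ok_leader.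
have [o3|o3] := boolP (ok (step i C) (ordS u)) => //=.
case: (stepP n_gt1 leNn) => //= [e _|_ _]; last by rewrite b0.
have ui : u = i by apply: (@ordS_injective n).
by move: o3; rewrite -ui (ok_extend n_gt1 leNn).
Qed.

Lemma exists_frontier C : has_leader C -> ~~ [forall u, ok C u] ->
  exists u, ok C u /\ ~~ ok C (ordS u).
Proof.
move=> /existsP[w lw] /forallPn[v nv].
have [/existsP[u /andP[h1 h2]]|/existsPn H] := boolP [exists u, ok C u && ~~ ok C (ordS u)].
  by exists u.
case/negP: nv; have [j _ ->] := posP n_gt1 w v.
elim: j => [|j IH]; first by apply: ok_leader.
by have := H (pos w j); rewrite IH /= negbK.
Qed.

Lemma phase_calm C : led C -> nohit R stepc (@calm N n) (2 * n * (0 + 2 * n + 3)) C <= 8^-1.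
Proof.
apply: (@nohit_mult_drift_bound R _ _ _ n_gt0 _ _ (fun C => 2 ^+ total_lag C)) => {C}.
- by move=> C lC _ i; apply: led_step.
- by move=> C; rewrite exprn_ge0.
- by move=> C _ _; rewrite expr0 exprn_ege1 ?ler1n.
- move=> C _ _; rewrite ler_weXn2l ?ler1n //.
  apply: leq_trans (_ : (\sum_(u < n) 2 <= _)%N); first by apply: leq_sum => u _; apply: lag_le2.
  by rewrite sum_nat_const card_ord mulnC.
move=> C lC; have /andP[lg hl] := lC; rewrite /calm lC /= => nok.
have f_ge0 D : 0 <= 2 ^+ total_lag D :> R by rewrite exprn_ge0.
apply: le_trans (@sum_if0_le (@calm N n) (fun C => 2 ^+ total_lag C) C f_ge0) _.
have mono i : (total_lag (step i C) <= total_lag C)%N.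
  by apply: leq_sum => u _; apply: lag_step.
have [i lt] : exists i, (total_lag (step i C) < total_lag C)%N.
  have strict i u : (lag (step i C) u < lag C u)%N -> exists i, (total_lag (step i C) < total_lag C)%N.
    move=> h; exists i; rewrite /total_lag (bigD1 u) //= [ltnRHS](bigD1 u) //= -addSn leq_add //.
    by apply: leq_sum => v _; apply: lag_step.
  have [u [o1 o2]] := exists_frontier hl nok.
  have lr : ~~ ld (cf C (ordS u)) by apply: contra o2; apply: ok_leader.
  case: (posnP (bu (cf C (ordS u)))) => b0.
    apply: (strict u (ordS u)); rewrite {2}/lag o2 /lag (ok_extend n_gt1 leNn) //=.
    by case: (_ && _).
  apply: (strict (ordS u) u); rewrite /lag o1 o2 b0 (ok_step n_gt1 leNn) //=.
  by rewrite cf_step_l //= andbF.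
rewrite (bigD1 i) //=.
have h1 : 2 ^+ total_lag (step i C) <= 2 ^+ total_lag C / 2 :> R.
  rewrite ler_pdivlMr // -exprSr ler_weXn2l // ler1n //.
have h2 : \sum_(j | j != i) 2 ^+ total_lag (step j C) <= (n%:R - 1) * 2 ^+ total_lag C :> R.
  apply: le_trans (_ : _ <= \sum_(j | j != i) 2 ^+ total_lag C) _.
    by apply: ler_sum => j _; rewrite ler_weXn2l ?ler1n.
  have := cardC1 i; rewrite card_ord => ci.
  rewrite sumr_const ci -[_ *+ _]mulr_natl -subn1 natrB //.
move: (2 ^+ total_lag C) (2 ^+ total_lag (step i C)) (\sum_(_ | _) _) h1 h2 => x y z; lra.
Qed.

End PhaseBounds.

(** * The race between two consecutive leaders *)

Section Race.
Local Open Scope ring_scope.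
Variable R : realFieldType.

Definition rate (g D : nat) : R := if D == g then 2 else 1.

(* Probability that a countdown from [D] ends before a countdown from [t].  The stage [g]
   of the former is the coin toss of a leader, which runs at double rate because two arcs
   trigger it. *)
Fixpoint race (g D : nat) : nat -> R :=
  if D is D'.+1 then
    fix aux (t : nat) : R :=
      if t is t'.+1 then
        (aux t' + rate g D'.+1 * race g D' t) / (1 + rate g D'.+1)
      else 0
  else fun t => (0 < t)%N%:R.

Lemma raceS g D t : race g D.+1 t.+1 =
  (race g D.+1 t + rate g D.+1 * race g D t.+1) / (1 + rate g D.+1).
Proof. by []. Qed.

Lemma race_t0 g D : race g D 0 = 0. Proof. by case: D. Qed.

Lemma race_D0 g t : race g 0 t.+1 = 1. Proof. by []. Qed.

Lemma raceS1 g D t : D.+1 != g ->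
  race g D.+1 t + race g D t.+1 = 2 * race g D.+1 t.+1.
Proof. by move=> /negbTE h; rewrite raceS /rate h; field. Qed.

Lemma raceS2 g D t : D.+1 = g ->
  race g D.+1 t + 2 * race g D t.+1 = 3 * race g D.+1 t.+1.
Proof. by move=> h; rewrite raceS /rate h eqxx; field. Qed.

Lemma rate_ge1 g D : 1 <= rate g D. Proof. by rewrite /rate; case: ifP => _; lra. Qed.

Lemma race_bound g D t : 0 <= race g D t <= 1.
Proof.
elim: D t => [|D IHD] t; first by case: t => [|t] /=; lra.
elim: t => [|t IHt]; first by rewrite race_t0; lra.
rewrite raceS; have r1 := rate_ge1 g D.+1; set r := rate _ _ in r1 *.
have /andP[a0 a1] := IHt; have /andP[b0 b1] := IHD t.+1.
by rewrite ler_pdivlMr ?ler_pdivrMr; [nra | lra | lra].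
Qed.

Lemma race_cross_mono g D : (forall t, race g D t <= race g D t.+1) /\
  (forall t, race g D.+1 t <= race g D t.+1).
Proof.
have cross E : (forall t, race g E t <= race g E t.+1) ->
    forall t, race g E.+1 t <= race g E t.+1.
  move=> mono; elim=> [|t IH].
    by rewrite race_t0; case/andP: (race_bound g E 1).
  apply: le_trans (mono t.+1); rewrite raceS.
  have r1 := rate_ge1 g E.+1; set r := rate _ _ in r1 *.
  by rewrite ler_pdivrMr; nra.
elim: D => [|D [IH1 IH2]].
  have m t : race g 0 t <= race g 0 t.+1 by case: t => [|t] /=; lra.
  by split=> //; apply: cross.
have m t : race g D.+1 t <= race g D.+1 t.+1.
  rewrite [leRHS]raceS; have r1 := rate_ge1 g D.+1; set r := rate _ _ in r1 *.
  by have := IH2 t; rewrite ler_pdivlMr; nra.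
by split=> //; apply: cross.
Qed.

Lemma race_mono g D s t : (s <= t)%N -> race g D s <= race g D t.
Proof.
move=> /subnKC <-; elim: (t - s)%N => [|k IH]; first by rewrite addn0.
by rewrite addnS; apply: le_trans IH ((race_cross_mono g D).1 _).
Qed.

Lemma race_antiS g D t : race g D.+1 t <= race g D t.
Proof.
case: t => [|t]; first by rewrite !race_t0.
rewrite raceS; have := (race_cross_mono g D).2 t.
have r1 := rate_ge1 g D.+1; set r := rate _ _ in r1 *.
by rewrite ler_pdivrMr; nra.
Qed.

Lemma race_small g D t : (D < g)%N -> race g D t = race 0 D t.
Proof.
elim: D t => [//|D IH] t Dg; elim: t => [|t IHt]; first by rewrite !race_t0.
rewrite !raceS IHt IH; last by lia.
by rewrite /rate ltn_eqF.
Qed.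

Lemma race_sym D t : (0 < D + t)%N -> race 0 D t + race 0 t D = 1.
Proof.
have [m] := ubnP (D + t); elim: m D t => // m IH D t lt Dt.
case: D lt Dt => [|D] lt Dt; first by rewrite race_t0 addr0 /= Dt.
case: t lt Dt => [|t] lt Dt; first by rewrite race_t0 add0r.
have h1 := IH D.+1 t ltac:(lia) ltac:(lia); have h2 := IH D t.+1 ltac:(lia) ltac:(lia).
have e1 := @raceS1 0 D t isT; have e2 := @raceS1 0 t D isT; lra.
Qed.

Lemma race_shift g D t : race g D.+1 t <= race 0 D t.
Proof.
elim: D t => [|D IHD] t.
  case: t => [|t]; first by rewrite race_t0.
  by rewrite race_D0; case/andP: (race_bound g 1 t.+1).
elim: t => [|t IHt]; first by rewrite !race_t0.
have [e|ne] := eqVneq D.+2 g.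
  apply: le_trans (race_antiS _ _ _) _; rewrite race_small ?lexx //; lia.
have := raceS1 t ne; have := @raceS1 0 D t isT; have := IHD t.+1; lra.
Qed.

Lemma race_half g D t : (t < D)%N -> race g D t <= 1/2.
Proof.
case: D => // D; rewrite ltnS => tD; apply: le_trans (race_shift g D t) _.
case: D tD => [|D] tD; first by move: tD; rewrite leqn0 => /eqP->; rewrite race_t0; lra.
apply: le_trans (race_mono _ _ tD) _.
have := @race_sym D.+1 D.+1 isT; lra.
Qed.

End Race.

Section Local.
Local Open Scope ring_scope.
Variables (R : realFieldType) (gu gv : nat).
Hypotheses (gu_gt0 : (0 < gu)%N) (gv_gt0 : (0 < gv)%N).
Implicit Types (s l : bool) (t D : nat) (om : R).
Local Notation race := (race R).

Definition drift_unit : R := (32 * (gu + gv)%:R)^-1.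
(* Probability that [v] is unshielded after [D] stages of [u], when [s] is the current
   shield of [v] and its next toss is [t] moves away: a toss makes it a fair coin. *)
Definition hit s t D : R := if s then 1/2 - race gu D t / 2 else 1/2 + race gu D t / 2.
(* The term that makes the drift strict.  If [gv < gu], the restart of [u] is always paid
   by [hit >= 1 / 4]; otherwise [v] may stay shielded during many rounds of [u], and then
   the progress of [v] towards its next toss has to be counted instead. *)
Definition work s t D : R :=
  if (gv < gu)%N then D%:R
  else if s then t%:R + 4 * (2 * gu%:R - 1)
  else 2 * (2 * gv%:R - 1) - 3 * t%:R + 4 * D%:R.
Definition normal_pot s t om D : R := - om * hit s t D + drift_unit * work s t D.

Let gu1 : (1 : R) <= gu%:R. Proof. by rewrite ler1n. Qed.
Let gv1 : (1 : R) <= gv%:R. Proof. by rewrite ler1n. Qed.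
Lemma drift_unit_gt0 : 0 < drift_unit.
Proof. by rewrite invr_gt0 mulr_gt0 // ltr0n; lia. Qed.
Lemma drift_unitE : drift_unit * gu%:R + drift_unit * gv%:R = 1/32.
Proof.
rewrite /drift_unit natrD; field; rewrite -natrD pnatr_eq0; lia.
Qed.
Let kgu : drift_unit <= drift_unit * gu%:R. Proof. by have := drift_unit_gt0; have := gu1; nra. Qed.
Let kgv : drift_unit <= drift_unit * gv%:R. Proof. by have := drift_unit_gt0; have := gv1; nra. Qed.

Lemma hit_bound s t D : 0 <= hit s t D <= 1.
Proof. by have := race_bound R gu D t; rewrite /hit; case: s; lra. Qed.

Lemma drift_move s t om D : om = 0 \/ D.+1 != gu ->
  normal_pot s t om D.+1 + normal_pot s t.+1 om D <= 2 * normal_pot s t.+1 om D.+1 - drift_unit.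
Proof.
move=> H; have k0 := drift_unit_gt0.
have E : om * (race gu D.+1 t + race gu D t.+1) = om * (2 * race gu D.+1 t.+1).
  by case: H => [->|/(raceS1 R)-> //]; rewrite !mul0r.
by rewrite /normal_pot /hit /work; case: s; case: ifP => _; lra.
Qed.

Lemma drift_toss_u s t D : D.+1 = gu ->
  normal_pot s t.+1 1 D + normal_pot s t.+1 0 D.+1 + normal_pot s t (1/2) D.+1 <= 3 * normal_pot s t.+1 (1/2) D.+1 - drift_unit.
Proof.
move=> H; have k0 := drift_unit_gt0; have E := raceS2 R t H.
by rewrite /normal_pot /hit /work; case: s; case: ifP => _; lra.
Qed.

Lemma drift_toss_u_meet t D :
  normal_pot false t.+1 1 D + normal_pot false t 0 D.+1 <= 2 * normal_pot false t.+1 (1/2) D.+1 - drift_unit.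
Proof.
have k0 := drift_unit_gt0; have E := race_antiS R gu D t.+1.
by rewrite /normal_pot /hit /work; case: ifP => _; lra.
Qed.

Lemma toss_v_hit D :
  1 <= hit false (2 * gv - 1) D + hit true (2 * gv - 2) D.
Proof.
have : (2 * gv - 2 <= 2 * gv - 1)%N by lia.
by move=> /(race_mono R gu D); rewrite /hit; lra.
Qed.

Let nat1 : (2 * gv - 1)%:R = 2 * gv%:R - 1 :> R.
Proof. by rewrite natrB ?natrM //; lia. Qed.
Let nat2 : (2 * gv - 2)%:R = 2 * gv%:R - 2 :> R.
Proof. by rewrite natrB ?natrM //; lia. Qed.

Lemma toss_v_work s D : (D.+1 <= 2 * gu - 1)%N ->
  work false (2 * gv - 1) D.+1 + work true (2 * gv - 2) D.+1 + work s 0 D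
    <= 3 * work s 0 D.+1 - 1.
Proof.
move=> Dle; have : D.+1%:R <= 2 * gu%:R - 1 :> R.
  have : (D.+1%:R <= (2 * gu - 1)%:R :> R) by rewrite ler_nat.
  by rewrite natrB ?natrM //; lia.
have D0 : (0 : R) <= D%:R by [].
rewrite /work nat1 nat2; case: ltnP => [_|h].
  by case: s; lra.
have : gu%:R <= gv%:R :> R by rewrite ler_nat.
by case: s; lra.
Qed.

Lemma drift_toss_v s om D : 0 <= om -> (0 < D)%N -> (D.+1 <= 2 * gu - 1)%N ->
  normal_pot false (2 * gv - 1) om D.+1 + normal_pot true (2 * gv - 2) om D.+1 + normal_pot s 0 om D
    <= 3 * normal_pot s 0 om D.+1 - drift_unit.
Proof.
move=> om0 D0 Dle; have k0 := drift_unit_gt0.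
have W := toss_v_work s Dle; have H := toss_v_hit D.+1.
have h0 E : hit s 0 E = 1/2 by rewrite /hit race_t0; case: s {W}; lra.
rewrite /normal_pot !h0.
have : 0 <= om * (hit false (2 * gv - 1) D.+1 + hit true (2 * gv - 2) D.+1 - 1).
  by rewrite mulr_ge0 // subr_ge0.
have : 0 <= drift_unit * (3 * work s 0 D.+1 - 1 - (work false (2 * gv - 1) D.+1 + work true (2 * gv - 2) D.+1 + work s 0 D)).
  by rewrite mulr_ge0 ?subr_ge0 // ltW.
lra.
Qed.

Lemma drift_toss_v_meet s :
  normal_pot false (2 * gv - 1) 0 0 + normal_pot true (2 * gv - 2) 0 1 <= 2 * normal_pot s 0 0 1 - drift_unit.
Proof.
have k0 := drift_unit_gt0; rewrite /normal_pot !mulNr !mul0r oppr0 !add0r.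
suff : work false (2 * gv - 1) 0 + work true (2 * gv - 2) 1 <= 2 * work s 0 1 - 1 by nra.
rewrite /work nat1 nat2; case: ltnP => [_|h]; first by lra.
have : gu%:R <= gv%:R :> R by rewrite ler_nat.
by have := gu1; case: s; lra.
Qed.

Lemma drift_toss_uv s D : (0 < D)%N -> (D.+1 <= 2 * gu - 1)%N ->
  normal_pot false (2 * gv - 1) (1/2) D.+1 + normal_pot true (2 * gv - 2) (1/2) D.+1
  + normal_pot s 0 1 D + normal_pot s 0 0 D.+1 <= 4 * normal_pot s 0 (1/2) D.+1 - drift_unit.
Proof.
move=> D0 Dle; have half0 : 0 <= 1/2 :> R by lra.
have := @drift_toss_v s (1/2) D half0 D0 Dle.
have h0 E : hit s 0 E = 1/2 by rewrite /hit race_t0; case: s; lra.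
by rewrite /normal_pot !h0; lra.
Qed.

Lemma restart s t : (t <= 2 * gv - 1)%N ->
  normal_pot s t (1/2) (2 * gu - 1) <= normal_pot s t 0 0.
Proof.
move=> tle; have k0 := drift_unit_gt0.
have e : (2 * gu - 1)%:R = 2 * gu%:R - 1 :> R by rewrite natrB ?natrM //; lia.
have kE := drift_unitE.
rewrite /normal_pot /work e; case: ltnP => [h|h].
  have : race gu (2 * gu - 1) t <= 1/2 by apply: race_half; lia.
  by have := race_bound R gu (2 * gu - 1) t; rewrite /hit; have := kgv; case: s; lra.
have := kgv; have := race_bound R gu (2 * gu - 1) t.
by rewrite /hit; case: s => rb kg; lra.
Qed.

Lemma restart_live t : (0 < t)%N -> (t <= 2 * gv - 1)%N ->
  normal_pot true t (1/2) (2 * gu - 1) <= normal_pot true t 1 0.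
Proof.
case: t => // t _ tle; apply: le_trans (restart _ tle) _.
by rewrite /normal_pot /hit race_D0; lra.
Qed.

Lemma normal_pot_bound s t om D : 0 <= om <= 1 -> (t <= 2 * gv - 1)%N -> (D <= 2 * gu - 1)%N ->
  - (3/2) <= normal_pot s t om D <= 1/2.
Proof.
move=> om01 tle Dle; have hb := hit_bound s t D; have k0 := drift_unit_gt0; have kE := drift_unitE.
have t1 : t%:R <= 2 * gv%:R - 1 :> R by rewrite -nat1 ler_nat.
have D1 : D%:R <= 2 * gu%:R - 1 :> R.
  have -> : 2 * gu%:R - 1 = (2 * gu - 1)%:R :> R by rewrite natrB ?natrM //; lia.
  by rewrite ler_nat.
have t0 : (0 : R) <= t%:R by []. have D0 : (0 : R) <= D%:R by [].
have kt : 0 <= drift_unit * t%:R <= drift_unit * (2 * gv%:R - 1) by nra.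
have kD : 0 <= drift_unit * D%:R <= drift_unit * (2 * gu%:R - 1) by nra.
have W : - (1/2) <= drift_unit * work s t D <= 1/2.
  by rewrite /work; case: ifP => _; [|case: s {hb}]; lra.
have : 0 <= om * hit s t D <= 1 by nra.
rewrite /normal_pot; lra.
Qed.

(* If the signal will be back at [u] after [t] moves, then [t < gu] means that it is on its
   way, and otherwise the bullet still has to reach [v].  [trip] is the number of stages
   until a bullet arrives at [v], and [stake] the probability that it is live. *)
Definition trip t : nat := if (t < gu)%N then (t + gu)%N else (t.+1 - gu)%N.
Definition stake l t : R :=
  if (t < gu)%N then 1/2 else if l && (t < 2 * gu - 1)%N then 1 else 0.
(* No kill is credited while a shielded [v] has no live bullet under way. *)
Definition local_pot s lv tv lu tu : R :=
  if [&& s, (gv <= tv)%N & ~~ lv] then 1 + drift_unit * tv%:R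
  else normal_pot s tv (stake lu tu) (trip tu).

Lemma stake_bound l t : 0 <= stake l t <= 1.
Proof. by rewrite /stake; case: ifP => _; [|case: ifP => _]; lra. Qed.

Lemma local_pot_bound s lv tv lu tu : (tv <= 2 * gv - 1)%N -> (tu <= 2 * gu - 1)%N ->
  - (3/2) <= local_pot s lv tv lu tu <= 3/2.
Proof.
move=> tvle tule; rewrite /local_pot; case: ifP => _.
  have k0 := drift_unit_gt0; have kE := drift_unitE.
  have t1 : tv%:R <= 2 * gv%:R - 1 :> R by rewrite -nat1 ler_nat.
  have t0 : (0 : R) <= tv%:R by [].
  have kt : 0 <= drift_unit * tv%:R <= drift_unit * (2 * gv%:R - 1) by nra.
  by have := kgu; lra.
have Dle : (trip tu <= 2 * gu - 1)%N by rewrite /trip; case: ifP => h; lia.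
by have := @normal_pot_bound s tv _ _ (stake_bound lu tu) tvle Dle; lra.
Qed.

End Local.

(** * Drift of the potential of a pair of leaders *)

Section SelectedArcs.
Variables (R : realFieldType) (n : nat).
Local Open Scope ring_scope.

Lemma sum_le_seq (S : seq 'I_n) (F : 'I_n -> R) :
  (forall e, e \notin S -> F e <= 0) -> \sum_e F e <= \sum_(e <- undup S) F e.
Proof.
move=> H; rewrite (bigID (mem S)) /= -[leRHS]addr0; apply: lerD.
  rewrite big_uniq ?undup_uniq //=; under [leRHS]eq_bigl => e do rewrite mem_undup.
  exact: lexx.
by apply: sumr_le0 => e; apply: H.
Qed.

Lemma sum_kill (S : seq 'I_n) (F : 'I_n -> R) k : k \in S -> (size S <= 4)%N ->
  (forall e, e \notin S -> F e <= 0) -> F k <= -14 -> (forall e, F e <= 3) ->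
  \sum_e F e <= -1.
Proof.
move=> kS sS H Fk F3; apply: le_trans (sum_le_seq H) _.
have kU : k \in undup S by rewrite mem_undup.
rewrite (perm_big _ (perm_to_rem kU)) big_cons.
have : \sum_(e <- rem k (undup S)) F e <= 9.
  apply: le_trans (_ : _ <= \sum_(e <- rem k (undup S)) 3) _; first by apply: ler_sum.
  rewrite big_const_seq count_predT iter_addr addr0 -mulr_natr.
  have : ((size (rem k (undup S))) <= 3)%N.
    by rewrite size_rem //; move: (leq_trans (size_undup S) sS); case: (size _).
  by rewrite -(ler_nat R); lra.
by move=> h; apply: le_trans (lerD Fk h) _; lra.
Qed.

End SelectedArcs.

Section Trips.
Local Open Scope ring_scope.
Variables (R : realFieldType) (gu : nat).
Hypothesis gu_gt0 : (0 < gu)%N.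
Implicit Types (t : nat) (l : bool).
Local Notation omof := (stake R gu).
Local Notation Dof := (trip gu).

Lemma trip_le t : (t <= 2 * gu - 1)%N -> (Dof t <= 2 * gu - 1)%N.
Proof. by rewrite /trip; case: ifP => h; lia. Qed.

Lemma trip_gt0 t : (0 < Dof t)%N.
Proof. by rewrite /trip; case: ifP => h; lia. Qed.

Lemma trip_gu l t : (0 < t)%N -> omof l t = 0 \/ Dof t != gu.
Proof.
move=> t0; rewrite /trip /stake; case: ltnP => lt; first by right; lia.
by case: ifP => [/andP[_ h]|_]; [right; lia | left].
Qed.

Lemma trip_pred t : (0 < t)%N -> t != gu -> (Dof t).-1 = Dof t.-1.
Proof. by rewrite /trip; do 2 (case: ifP => ?); lia. Qed.

Lemma trip_arrival : Dof gu = 1%N. Proof. by rewrite /trip ltnn; lia. Qed.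
Lemma trip_restart : Dof gu.-1 = (2 * gu - 1)%N.
Proof. by rewrite /trip; case: ifP => h; lia. Qed.
Lemma trip_toss : Dof 0 = gu. Proof. by rewrite /trip gu_gt0. Qed.
Lemma trip_live : (1 < gu)%N -> Dof (2 * gu - 2) = gu.-1.
Proof. by rewrite /trip; case: ifP => h; lia. Qed.
Lemma trip_dummy : Dof (2 * gu - 1) = gu.
Proof. by rewrite /trip; case: ifP => h; lia. Qed.

Lemma trip_ge2 t : (0 < t)%N -> t != gu -> (1 < Dof t)%N.
Proof. by rewrite /trip; case: ifP => ?; lia. Qed.

Lemma stake_ret l t : (t < gu)%N -> omof l t = 1/2. Proof. by rewrite /stake => ->. Qed.
Lemma stake_live : (1 < gu)%N -> omof true (2 * gu - 2) = 1.
Proof. by move=> h; rewrite /stake ifF /= ?ifT //; lia. Qed.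
Lemma stake_dummy l : omof l (2 * gu - 1) = 0.
Proof. by rewrite /stake ltnn andbF ifF //; lia. Qed.
Lemma stake_arrival l : omof l gu = if l && (1 < gu)%N then 1 else 0.
Proof.
rewrite /stake ltnn; congr (if _ && _ then _ else _).
by apply/idP/idP; lia.
Qed.

Lemma stake_mono (l l1 : bool) t : ((gu <= t)%N -> l -> l1) -> omof l t <= omof l1 t.
Proof.
rewrite /stake; case: ltnP => // le /(_ isT); case: l => [/(_ isT)->|_] //=.
by case: ifP => _; lra.
Qed.

Lemma stake_pred (l l1 : bool) t : (0 < t)%N -> t != gu -> ((gu <= t.-1)%N -> l -> l1) ->
  omof l t <= omof l1 t.-1.
Proof.
move=> t0 tg h; case: (ltnP t gu) => lt.
  by rewrite !stake_ret //; lia.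
apply: le_trans (_ : _ <= omof l t.-1) _; last by apply: stake_mono.
have lt1 : (t.-1 < gu)%N = false by lia.
rewrite /stake ltnNge lt lt1 /=; case: l {h} => //=; case: ltnP => ? /=.
  by rewrite ifT //; lia.
by case: ifP => _; lra.
Qed.

End Trips.

Section LocalDrift.
Local Open Scope ring_scope.
Variables (R : realFieldType) (n gu gv : nat).
Hypotheses (gu_gt0 : (0 < gu)%N) (gv_gt0 : (0 < gv)%N).
Variables (s lv lu : bool) (tv tu : nat).
Variables (kl s' lv' lu' : 'I_n -> bool) (tv' tu' : 'I_n -> nat).
Variables (eu pu ev pv au av : 'I_n).
Local Notation h0 := (local_pot R gu gv s lv tv lu tu).
Local Notation h' e := (local_pot R gu gv (s' e) (lv' e) (tv' e) (lu' e) (tu' e)).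
Local Notation hn := (@normal_pot R gu gv).
Local Notation omof := (stake R gu).
Local Notation Dof := (trip gu).
Local Notation kk := (drift_unit R gu gv).

Definition delta e : R := if kl e then -14 else h' e - h0.

Hypotheses (tv_le : (tv <= 2 * gv - 1)%N) (tu_le : (tu <= 2 * gu - 1)%N).
Hypothesis tv'_le : forall e, ~~ kl e -> (tv' e <= 2 * gv - 1)%N.
Hypothesis tu'_le : forall e, ~~ kl e -> (tu' e <= 2 * gu - 1)%N.
Hypothesis vmove : (0 < tv)%N -> forall e, ~~ kl e ->
  [/\ s' e = s, tv' e = if e == av then tv.-1 else tv & ((gv <= tv' e)%N -> lv -> lv' e)].
Hypothesis vtoss : tv = 0%N -> forall e, ~~ kl e ->
  if e == ev then [/\ s' e, (1 < gv)%N -> lv' e & tv' e = 2 * gv - 2]%N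
  else if e == pv then ~~ s' e /\ tv' e = (2 * gv - 1)%N
  else s' e = s /\ tv' e = 0%N.
Hypothesis umove : (0 < tu)%N -> forall e, ~~ kl e ->
  tu' e = (if e == au then tu.-1 else tu) /\ ((gu <= tu' e)%N -> lu -> lu' e).
Hypothesis utoss : tu = 0%N -> forall e, ~~ kl e ->
  if e == eu then ((1 < gu)%N -> lu' e) /\ tu' e = (2 * gu - 2)%N
  else if e == pu then tu' e = (2 * gu - 1)%N
  else tu' e = 0%N.
Hypotheses (eupu : eu != pu) (evpv : ev != pv) (eupv : (eu == pv) = (gu == 1)%N).
Hypotheses (euev : eu != ev) (pupv : pu != pv).
Hypothesis avP : (0 < tv)%N -> [/\ av != eu, av != pv & av = pu -> tv = gv].
Hypothesis auP : (0 < tu)%N -> [/\ au != ev, au != pu & (au == pv) = (tu == gu)].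
Hypothesis auav : (0 < tv)%N -> (0 < tu)%N -> au != av.
Hypothesis kill_arrival : tu = gu -> lu -> (1 < gu)%N -> ~~ s \/ tv = 0%N -> kl pv.
Hypothesis kill_adjacent : gu = 1%N -> tu = 0%N -> ~~ s \/ tv = 0%N -> kl pv.
Hypothesis kill_back : av = pu -> tu = 0%N -> tv = gv -> lv -> kl pu.
Hypothesis kill_back_adjacent : ev = pu -> tv = 0%N -> tu = 0%N -> kl pu.

Let kk0 : 0 < kk. Proof. exact: drift_unit_gt0. Qed.
Let kk1 : kk <= 1/32.
Proof.
have := drift_unitE R gu_gt0 gv_gt0; have : (1 : R) <= gu%:R by rewrite ler1n.
have : (0 : R) <= gv%:R by []. have := kk0; nra.
Qed.

Lemma delta_le3 e : delta e <= 3.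
Proof.
rewrite /delta; case: ifP => [_|/negbT ke]; first by lra.
have := local_pot_bound R gu_gt0 gv_gt0 s lv lu tv_le tu_le.
have := local_pot_bound R gu_gt0 gv_gt0 (s' e) (lv' e) (lu' e) (tv'_le ke) (tu'_le ke).
lra.
Qed.

Lemma hit_ge0 s1 t D : 0 <= hit R gu s1 t D.
Proof. by case/andP: (hit_bound R gu s1 t D). Qed.

Lemma hn_om s1 t om om1 D : om <= om1 -> hn s1 t om1 D <= hn s1 t om D.
Proof.
by move=> le; rewrite /normal_pot lerD2r !mulNr lerN2 ler_wpM2r // hit_ge0.
Qed.

Definition abn := [&& s, (gv <= tv)%N & ~~ lv].

Lemma local_pot_normal s1 lv1 t1 lu1 u1 : ~~ [&& s1, (gv <= t1)%N & ~~ lv1] ->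
  local_pot R gu gv s1 lv1 t1 lu1 u1 = hn s1 t1 (omof lu1 u1) (Dof u1).
Proof. by rewrite /local_pot => /negbTE ->. Qed.

Lemma abn_le s1 lv1 t1 lu1 u1 : (t1 <= 2 * gv - 1)%N -> (u1 <= 2 * gu - 1)%N ->
  local_pot R gu gv s1 lv1 t1 lu1 u1 <= 1 + kk * t1%:R.
Proof.
move=> t1le u1le; rewrite /local_pot; case: ifP => // _.
have := normal_pot_bound gu_gt0 gv_gt0 s1 (stake_bound R gu lu1 u1) t1le (trip_le gu_gt0 u1le).
have : 0 <= kk * t1%:R by rewrite mulr_ge0 // ltW.
lra.
Qed.

Lemma idle e : ~~ kl e -> s' e = s -> tv' e = tv -> tu' e = tu ->
  ((gv <= tv)%N -> lv -> lv' e) -> ((gu <= tu)%N -> lu -> lu' e) -> h' e <= h0.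
Proof.
move=> ke -> -> -> hv hu; rewrite /local_pot; case: ifP => [/and3P[h1 h2 h3]|].
  by rewrite h1 h2; case: (lv) hv => [/(_ h2 isT)|_] //; rewrite (negbTE h3).
move=> _; case: ifP => a1.
  have := normal_pot_bound gu_gt0 gv_gt0 s (stake_bound R gu (lu' e) tu) tv_le (trip_le gu_gt0 tu_le).
  have : 0 <= kk * tv%:R by rewrite mulr_ge0 // ltW.
  lra.
by apply: hn_om; apply: stake_mono.
Qed.

Let u_idle e : ~~ kl e -> ((0 < tu)%N -> e <> au) -> (tu = 0%N -> e <> eu /\ e <> pu) ->
  tu' e = tu /\ ((gu <= tu)%N -> lu -> lu' e).
Proof.
move=> ke h1 h2; case: (posnP tu) => t0.
  have [/eqP/negbTE a /eqP/negbTE b] := h2 t0.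
  by have := utoss t0 ke; rewrite a b => ->; split=> //; rewrite t0 leqNgt gu_gt0.
have [e1 e2] := umove t0 ke.
have /eqP/negbTE a := h1 t0; rewrite a in e1.
by split=> // le l; apply: e2 => //; rewrite e1.
Qed.

Let v_idle e : ~~ kl e -> ((0 < tv)%N -> e <> av) -> (tv = 0%N -> e <> ev /\ e <> pv) ->
  [/\ s' e = s, tv' e = tv & ((gv <= tv)%N -> lv -> lv' e)].
Proof.
move=> ke h1 h2; case: (posnP tv) => t0.
  have [/eqP/negbTE a /eqP/negbTE b] := h2 t0.
  by have := vtoss t0 ke; rewrite a b => -[-> ->]; split=> //; rewrite t0 leqNgt gv_gt0.
have [e1 e2 e3] := vmove t0 ke.
have /eqP/negbTE a := h1 t0; rewrite a in e2.
by split=> // le l; apply: e3 => //; rewrite e2.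
Qed.

Definition rel_arcs : seq 'I_n :=
  (if tv == 0%N then [:: ev; pv] else [:: av]) ++ (if tu == 0%N then [:: eu; pu] else [:: au]).

Lemma rel_size : (size rel_arcs <= 4)%N.
Proof. by rewrite size_cat; case: ifP => _; case: ifP. Qed.

Lemma delta_idle e : e \notin rel_arcs -> delta e <= 0.
Proof.
rewrite mem_cat negb_or => /andP[nv nu]; rewrite /delta; case: ifP => [_|/negbT ke]; first by lra.
rewrite subr_le0.
have [] := v_idle ke _ _.
- by move=> t0 E; move: nv; rewrite -(negbK (tv == _)) -lt0n t0 /= inE E eqxx.
- move=> t0; move: nv; rewrite t0 eqxx !inE negb_or => /andP[/eqP a /eqP b]; by split.
move=> a1 a2 a3.
have [] := u_idle ke _ _.
- by move=> t0 E; move: nu; rewrite -(negbK (tu == _)) -lt0n t0 /= inE E eqxx.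
- move=> t0; move: nu; rewrite t0 eqxx !inE negb_or => /andP[/eqP a /eqP b]; by split.
by move=> b1 b2; apply: idle.
Qed.

Lemma delta_kill k : k \in rel_arcs -> kl k -> \sum_e delta e <= - kk.
Proof.
move=> kS kk'; have : \sum_e delta e <= -1.
  apply: sum_kill kS rel_size delta_idle _ delta_le3.
  by rewrite /delta kk'.
have := kk1; lra.
Qed.

(* When the bullet reaches [v], a new round starts, which is paid for by [restart]. *)
Let u_dec e s1 t1 : (0 < tu)%N -> ~~ kl e -> e = au -> (t1 <= 2 * gv - 1)%N ->
  (tu = gu -> lu -> (1 < gu)%N -> s1 && (0 < t1)%N) ->
  hn s1 t1 (omof (lu' e) (tu' e)) (Dof (tu' e)) <= hn s1 t1 (omof lu tu) (Dof tu).-1.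
Proof.
move=> t0 ke ea t1le H; have [e1 e2] := umove t0 ke; rewrite ea eqxx -ea in e1.
rewrite e1 in e2 *.
have [eq|ne] := eqVneq tu gu; last first.
  by rewrite trip_pred //; apply: hn_om; apply: stake_pred.
have o1 : omof (lu' e) gu.-1 = 1/2 by rewrite stake_ret // prednK.
rewrite eq trip_restart // o1 trip_arrival // stake_arrival //; case: ifP => [/andP[l1 l2]|_]; last exact: restart.
have /andP[-> h2] := H eq l1 l2; exact: restart_live.
Qed.

Let abn_move : (0 < tv)%N -> abn -> \sum_e delta e <= - kk.
Proof.
move=> t0 ab; have h0E : h0 = 1 + kk * tv%:R by rewrite /local_pot ifT.
have le0 e : ~~ kl e -> delta e <= if e == av then - kk else 0.
  move=> ke; rewrite /delta (negbTE ke) h0E.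
  have [e1 e2 e3] := vmove t0 ke.
  have := abn_le (s' e) (lv' e) (lu' e) (tv'_le ke) (tu'_le ke).
  rewrite e2; case: ifP => _; last by lra.
  have -> : tv%:R = tv.-1%:R + 1 :> R by rewrite -[in LHS](prednK t0) -natr1.
  lra.
have [ka|ka] := boolP (kl av); first by apply: delta_kill ka; rewrite mem_cat -(negbK (tv == _)) -lt0n t0 /= inE eqxx.
rewrite (bigD1 av) //= -[leRHS]addr0; apply: lerD; first by have := le0 _ ka; rewrite eqxx.
apply: sumr_le0 => e /negbTE ea; have [ke|ke] := boolP (kl e); first by rewrite /delta ke; lra.
by have := le0 _ ke; rewrite ea.
Qed.

Let normal_new e t1 : (0 < tv)%N -> ~~ abn -> ~~ kl e -> tv' e = t1 -> (t1 <= tv)%N ->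
  h' e = hn s t1 (omof (lu' e) (tu' e)) (Dof (tu' e)).
Proof.
move=> t0 nab ke e1 tle; have [-> _ e3] := vmove t0 ke; rewrite -e1.
apply: local_pot_normal; apply: contra nab => /and3P[h1 h2 h3].
apply/and3P; split=> //; first by rewrite e1 in h2; apply: leq_trans h2 tle.
by apply: contra h3; apply: e3.
Qed.

Let D1 : (Dof tu) = (Dof tu).-1.+1. Proof. by rewrite prednK // trip_gt0. Qed.

Lemma drift_both_move : (0 < tv)%N -> (0 < tu)%N -> \sum_e delta e <= - kk.
Proof.
move=> tv0 tu0; have [ab|nab] := boolP abn; first exact: abn_move.
have rE : rel_arcs = [:: av; au].
  by rewrite /rel_arcs !gtn_eqF.
have [ka|ka] := boolP (kl av); first by apply: delta_kill ka; rewrite rE inE eqxx.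
have [kb|kb] := boolP (kl au); first by apply: delta_kill kb; rewrite rE !inE eqxx orbT.
have ne := auav tv0 tu0.
apply: le_trans (sum_le_seq delta_idle) _.
rewrite rE undup_id ?[uniq _]/= ?inE 1?eq_sym ?ne // !big_cons big_nil addr0 /delta (negbTE ka) (negbTE kb).
have [s1 t1 _] := vmove tv0 ka; rewrite eqxx in t1.
have [s2 t2 _] := vmove tv0 kb; rewrite (negbTE ne) in t2.
rewrite (normal_new tv0 nab ka t1 (leq_pred _)) (normal_new tv0 nab kb t2 (leqnn _)).
rewrite (local_pot_normal _ _ nab).
have [tu1 lu1] : tu' av = tu /\ ((gu <= tu)%N -> lu -> lu' av).
  apply: u_idle => //; last by move=> t00; rewrite t00 in tu0.
  by move=> _ E; rewrite E eqxx in ne.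
rewrite tu1.
have A : hn s tv.-1 (omof (lu' av) tu) (Dof tu) <= hn s tv.-1 (omof lu tu) (Dof tu).
  by apply: hn_om; apply: stake_mono.
have B : hn s tv (omof (lu' au) (tu' au)) (Dof (tu' au)) <= hn s tv (omof lu tu) (Dof tu).-1.
  apply: u_dec => // eq lu1' gu1; rewrite tv0 andbT; apply/negPn/negP => ns.
  have [_ _ h] := auP tu0; move: h; rewrite eq eqxx => /eqP h.
  by move: kb; rewrite h (kill_arrival eq) //; left.
have := @drift_move R gu gv gu_gt0 gv_gt0 s tv.-1 (omof lu tu) (Dof tu).-1.
rewrite -D1 prednK // => /(_ (trip_gu R gu_gt0 lu tu0)); lra.
Qed.

(* A bullet fired across a gap of length 1 arrives at once. *)
Let u_fire s1 t1 e : tu = 0%N -> ~~ kl e -> e = eu -> (t1 <= 2 * gv - 1)%N ->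
  ((gu = 1)%N -> s1 && (0 < t1)%N) ->
  hn s1 t1 (omof (lu' e) (tu' e)) (Dof (tu' e)) <= hn s1 t1 1 gu.-1.
Proof.
move=> t0 ke ee t1le H; have := utoss t0 ke; rewrite ee eqxx -ee => -[hl ->].
case: (ltngtP gu 1) => [|gu1|gu1]; first by rewrite ltnNge gu_gt0.
  by rewrite hl // stake_live // trip_live.
have /andP[-> h2] := H gu1.
have := restart_live R gu_gt0 gv_gt0 h2 t1le; rewrite gu1 /=.
by rewrite /stake /trip.
Qed.

Let u_misfire s1 t1 e : tu = 0%N -> ~~ kl e -> e = pu ->
  hn s1 t1 (omof (lu' e) (tu' e)) (Dof (tu' e)) = hn s1 t1 0 gu.
Proof.
move=> t0 ke ee; have := utoss t0 ke.
rewrite ee [pu == eu]eq_sym (negbTE eupu) eqxx -ee => ->.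
by rewrite stake_dummy // trip_dummy.
Qed.

Let u_wait s1 t1 e : ~~ kl e -> ((0 < tu)%N -> e <> au) -> (tu = 0%N -> e <> eu /\ e <> pu) ->
  hn s1 t1 (omof (lu' e) (tu' e)) (Dof (tu' e)) <= hn s1 t1 (omof lu tu) (Dof tu).
Proof.
move=> ke h1 h2; have [-> h] := u_idle ke h1 h2.
by apply: hn_om; apply: stake_mono.
Qed.

Let g_pred : gu.-1.+1 = gu. Proof. by rewrite prednK. Qed.

Lemma drift_u_toss : (0 < tv)%N -> tu = 0%N -> \sum_e delta e <= - kk.
Proof.
move=> tv0 tu0; have [ab|nab] := boolP abn; first exact: abn_move.
have rE : rel_arcs = [:: av; eu; pu] by rewrite /rel_arcs tu0 gtn_eqF.
have [ka|ka] := boolP (kl av); first by apply: delta_kill ka; rewrite rE inE eqxx.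
have [kb|kb] := boolP (kl eu); first by apply: delta_kill kb; rewrite rE !inE eqxx orbT.
have [kc|kc] := boolP (kl pu); first by apply: delta_kill kc; rewrite rE !inE eqxx !orbT.
have [av1 av2 av3] := avP tv0.
have h0E : h0 = hn s tv (1/2) gu by rewrite (local_pot_normal _ _ nab) tu0 stake_ret // trip_toss.
have [_ t1 _] := vmove tv0 ka; rewrite eqxx in t1.
have [_ t2 _] := vmove tv0 kb; rewrite eq_sym (negbTE av1) in t2.
have B : h' eu <= hn s tv 1 gu.-1.
  rewrite (normal_new tv0 nab kb t2 (leqnn _)); apply: u_fire => // gu1.
  rewrite tv0 andbT; apply/negPn/negP => ns.
  have /eqP e : eu == pv by rewrite eupv gu1.
  by move: kb; rewrite e (kill_adjacent gu1) //; left.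
have [e|ne] := eqVneq av pu.
  have ns : s = false.
    apply/negbTE/negP => s1; have tg := av3 e.
    have l1 : lv by apply: contraNT nab => nl; rewrite /abn s1 nl tg leqnn.
    by move: kc; rewrite (kill_back e tu0 tg l1).
  apply: le_trans (sum_le_seq delta_idle) _.
  have -> : undup rel_arcs = [:: eu; av].
    by rewrite rE -e /= !inE eqxx orbT (negbTE (_ : eu != av)) // eq_sym.
  rewrite !big_cons big_nil addr0 /delta (negbTE ka) (negbTE kb) h0E.
  have A : h' av = hn s tv.-1 0 gu.
    by rewrite (normal_new tv0 nab ka t1 (leq_pred _)); apply: u_misfire.
  have := @drift_toss_u_meet R gu gv gu_gt0 gv_gt0 tv.-1 gu.-1.
  rewrite prednK // g_pred A ns; rewrite ns in B; lra.
have [_ t3 _] := vmove tv0 kc; rewrite eq_sym (negbTE ne) in t3.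
apply: le_trans (sum_le_seq delta_idle) _.
rewrite rE undup_id; last by rewrite /= !inE (negbTE av1) (negbTE ne) (negbTE eupu).
rewrite !big_cons big_nil addr0 /delta (negbTE ka) (negbTE kb) (negbTE kc) h0E.
have A : h' av <= hn s tv.-1 (1/2) gu.
  rewrite (normal_new tv0 nab ka t1 (leq_pred _)).
  have := @u_wait s tv.-1 av ka; rewrite tu0 (stake_ret R lu gu_gt0) trip_toss //; apply=> // _.
  by split; apply/eqP.
have E : h' pu = hn s tv 0 gu.
  by rewrite (normal_new tv0 nab kc t3 (leqnn _)); apply: u_misfire.
have := @drift_toss_u R gu gv gu_gt0 gv_gt0 s tv.-1 gu.-1 g_pred.
rewrite prednK // g_pred E; lra.
Qed.

Let v_fire e : tv = 0%N -> ~~ kl e -> e = ev ->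
  h' e = hn true (2 * gv - 2) (omof (lu' e) (tu' e)) (Dof (tu' e)).
Proof.
move=> t0 ke ee; have := vtoss t0 ke; rewrite ee eqxx -ee => -[h1 h2 h3].
rewrite local_pot_normal ?h1 ?h3 //; apply/negP => /and3P[_ le].
case: (ltngtP gv 1) => [|/h2->//|g1]; first by rewrite ltnNge gv_gt0.
by rewrite g1 in le.
Qed.

Let v_misfire e : tv = 0%N -> ~~ kl e -> e = pv ->
  h' e = hn false (2 * gv - 1) (omof (lu' e) (tu' e)) (Dof (tu' e)).
Proof.
move=> t0 ke ee; have := vtoss t0 ke.
rewrite ee [pv == ev]eq_sym (negbTE evpv) eqxx -ee => -[/negbTE h1 h3].
by rewrite local_pot_normal ?h1 ?h3.
Qed.

Let v_wait e : tv = 0%N -> ~~ kl e -> e != ev -> e != pv ->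
  h' e = hn s 0 (omof (lu' e) (tu' e)) (Dof (tu' e)).
Proof.
move=> t0 ke /negbTE n1 /negbTE n2; have := vtoss t0 ke; rewrite n1 n2 => -[h1 h2].
by rewrite local_pot_normal ?h1 ?h2 // leqNgt gv_gt0 andbF.
Qed.

Let h0_toss : tv = 0%N -> h0 = hn s 0 (omof lu tu) (Dof tu).
Proof.
move=> t0; have n0 : ~~ [&& s, (gv <= tv)%N & ~~ lv] by rewrite t0 leqNgt gv_gt0 andbF.
by rewrite (local_pot_normal _ _ n0) t0.
Qed.

Lemma drift_v_toss : tv = 0%N -> (0 < tu)%N -> \sum_e delta e <= - kk.
Proof.
move=> tv0 tu0.
have rE : rel_arcs = [:: ev; pv; au] by rewrite /rel_arcs tv0 eqxx (gtn_eqF tu0).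
have [ka|ka] := boolP (kl ev); first by apply: delta_kill ka; rewrite rE inE eqxx.
have [kb|kb] := boolP (kl pv); first by apply: delta_kill kb; rewrite rE !inE eqxx orbT.
have [kc|kc] := boolP (kl au); first by apply: delta_kill kc; rewrite rE !inE eqxx !orbT.
have [au1 au2 au3] := auP tu0.
have tu_n0 : tu <> 0%N by move=> e; rewrite e in tu0.
have A : h' ev <= hn true (2 * gv - 2) (omof lu tu) (Dof tu).
  rewrite v_fire //; apply: u_wait => // _ E; by rewrite E eqxx in au1.
have [tg|ne] := eqVneq tu gu.
  have e : au = pv by apply/eqP; rewrite au3 tg.
  have om0 : omof lu tu = 0.
    rewrite tg stake_arrival //; case: ifP => // /andP[l1 g1].
    by move: kb; rewrite (kill_arrival tg l1 g1) //; right.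
  apply: le_trans (sum_le_seq delta_idle) _.
  have -> : undup rel_arcs = [:: ev; pv].
    by rewrite rE e /= !inE eqxx (negbTE evpv).
  rewrite !big_cons big_nil addr0 /delta (negbTE ka) (negbTE kb) h0_toss //.
  have B : h' pv <= hn false (2 * gv - 1) (omof lu tu) (Dof tu).-1.
    rewrite v_misfire //; apply: u_dec => // _ l1 g1.
    by move: kb; rewrite (kill_arrival tg l1 g1) //; right.
  have := @drift_toss_v_meet R gu gv gu_gt0 gv_gt0 s.
  rewrite om0 tg trip_arrival // in A B *; rewrite /= in B *; lra.
have nap : au != pv by rewrite au3 (negbTE ne).
apply: le_trans (sum_le_seq delta_idle) _.
rewrite rE undup_id; last first.
  by rewrite /= !inE (negbTE evpv) ![_ == au]eq_sym (negbTE au1) (negbTE nap).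
rewrite !big_cons big_nil addr0 /delta (negbTE ka) (negbTE kb) (negbTE kc) h0_toss //.
have B : h' pv <= hn false (2 * gv - 1) (omof lu tu) (Dof tu).
  rewrite v_misfire //; apply: u_wait => // _ E; by rewrite E eqxx in nap.
have E : h' au <= hn s 0 (omof lu tu) (Dof tu).-1.
  by rewrite v_wait //; apply: u_dec => // tg; rewrite tg eqxx in ne.
have om0 : 0 <= omof lu tu by case/andP: (stake_bound R gu lu tu).
have D2 := trip_ge2 gu_gt0 tu0 ne.
have := @drift_toss_v R gu gv gu_gt0 gv_gt0 s (omof lu tu) (Dof tu).-1 om0.
rewrite -D1 -ltnS -D1 => /(_ D2 (trip_le gu_gt0 tu_le)); lra.
Qed.

Lemma drift_both_toss : tv = 0%N -> tu = 0%N -> \sum_e delta e <= - kk.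
Proof.
move=> tv0 tu0.
have rE : rel_arcs = [:: ev; pv; eu; pu] by rewrite /rel_arcs tv0 tu0.
have [ka|ka] := boolP (kl ev); first by apply: delta_kill ka; rewrite rE inE eqxx.
have [kb|kb] := boolP (kl pv); first by apply: delta_kill kb; rewrite rE !inE eqxx orbT.
have [kc|kc] := boolP (kl eu); first by apply: delta_kill kc; rewrite rE !inE eqxx !orbT.
have [kd|kd] := boolP (kl pu); first by apply: delta_kill kd; rewrite rE !inE eqxx !orbT.
have gu1 : gu != 1%N.
  by apply/eqP => g1; move: kb; rewrite (kill_adjacent g1) //; right.
have evpu : ev != pu by apply/eqP => e; move: kd; rewrite kill_back_adjacent.
have eupv' : eu != pv by rewrite eupv.
have h0E : h0 = hn s 0 (1/2) gu by rewrite h0_toss // tu0 stake_ret // trip_toss.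
apply: le_trans (sum_le_seq delta_idle) _.
rewrite rE undup_id; last first.
  rewrite /= !inE (negbTE evpv) [ev == eu]eq_sym (negbTE euev) (negbTE evpu).
  by rewrite [pv == eu]eq_sym (negbTE eupv') [pv == pu]eq_sym (negbTE pupv) (negbTE eupu).
rewrite !big_cons big_nil addr0 /delta (negbTE ka) (negbTE kb) (negbTE kc) (negbTE kd) h0E.
have A : h' ev <= hn true (2 * gv - 2) (1/2) gu.
  rewrite v_fire //; have := @u_wait true (2 * gv - 2)%N ev ka.
  rewrite tu0 (stake_ret R lu gu_gt0) trip_toss //; apply=> // _.
  by split; apply/eqP; rewrite // eq_sym.
have B : h' pv <= hn false (2 * gv - 1) (1/2) gu.
  rewrite v_misfire //; have := @u_wait false (2 * gv - 1)%N pv kb.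
  rewrite tu0 (stake_ret R lu gu_gt0) trip_toss //; apply=> // _.
  by split; apply/eqP; rewrite // eq_sym.
have E : h' eu <= hn s 0 1 gu.-1.
  rewrite v_wait //; apply: u_fire => // g1; by rewrite g1 in gu1.
have F : h' pu = hn s 0 0 gu.
  by rewrite v_wait //; [apply: u_misfire | rewrite eq_sym].
have := @drift_toss_uv R gu gv gu_gt0 gv_gt0 s gu.-1; rewrite g_pred F.
have g2 : (1 < gu)%N by rewrite ltn_neqAle eq_sym gu1.
have g3 : (gu <= 2 * gu - 1)%N by rewrite leq_subRL ?mul2n -?addnn ?leq_add2r // addn_gt0 gu_gt0.
by rewrite -ltnS g_pred => /(_ g2 g3); lra.
Qed.

Theorem local_drift : \sum_e delta e <= - kk.
Proof.
case: (posnP tv) => tv0; case: (posnP tu) => tu0.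
- exact: drift_both_toss.
- exact: drift_v_toss.
- exact: drift_u_toss.
- exact: drift_both_move.
Qed.

End LocalDrift.

(** * Gaps between leaders *)

Arguments pos : simpl never.

Section Gaps.
Variables (N n : nat).
Hypothesis (n_gt1 : 1 < n) (leNn : n <= N).
Implicit Types (C : config N n) (e i u v w x y : 'I_n).
Let n_gt0 : 0 < n. Proof. by lia. Qed.

Definition gap C x : nat := (find (fun j => ld (cf C (pos x j.+1))) (iota 0 n)).+1.
Arguments gap : simpl never.
Definition next C x : 'I_n := pos x (gap C x).
Definition busy (a : agent) : bool := (0 < bu a) || sg a.
Definition front C x : nat := find (fun j => busy (cf C (pos x j))) (iota 0 (gap C x)).
(* Number of moves until the signal is back at the leader, when its gap has length [g] and
   [k] is the first place holding a bullet ([b = true]) or a signal; a bullet has to reach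
   the next leader first, and [k = g] means that this leader has yet to send a signal. *)
Definition delay g k (b : bool) : nat :=
  if k == g then g else if b then 2 * g - 1 - k else k.
Definition wait C x : nat :=
  delay (gap C x) (front C x) (0 < bu (cf C (pos x (front C x)))).
Definition armed C x : bool :=
  [exists j : 'I_n, (j < gap C x) && (bu (cf C (pos x j)) == 2)] &&
  [forall j : 'I_n, (j < gap C x) ==> (bu (cf C (pos x j)) != 1)].

Definition is_gap C x g := [/\ 0 < g <= n, ld (cf C (pos x g))
  & forall j, 0 < j < g -> ~~ ld (cf C (pos x j))].
Definition is_front C x g k := [/\ k <= g, forall j, j < k -> ~~ busy (cf C (pos x j))
  & k < g -> busy (cf C (pos x k))].

Lemma find_iota (P : pred nat) k m : k <= m -> (forall j, j < k -> ~~ P j) ->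
  (k < m -> P k) -> find P (iota 0 m) = k.
Proof.
move=> km H Pk; rewrite -(subnKC km) iotaD add0n find_cat size_iota.
have -> : has P (iota 0 k) = false.
  by apply/negbTE/hasPn => j; rewrite mem_iota add0n => /andP[_]; apply: H.
case E : (m - k) => [|d] /=; first by rewrite addn0.
by rewrite Pk ?addn0 //; lia.
Qed.

Lemma gapP C x : ld (cf C x) -> is_gap C x (gap C x).
Proof.
move=> lx; set P := fun j => ld (cf C (pos x j.+1)).
have hP : has P (iota 0 n).
  by apply/hasP; exists n.-1; rewrite ?mem_iota /P ?prednK ?posn //; lia.
have lt : find P (iota 0 n) < n by rewrite has_find size_iota in hP.
split; rewrite /gap -/P //.
  by have := nth_find 0 hP; rewrite nth_iota.
case=> // j /andP[_ lj]; have jf : j < find P (iota 0 n) by [].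
by have /negbT := before_find 0 jf; rewrite nth_iota ?add0n //; lia.
Qed.

Lemma gap_uniq C x g : is_gap C x g -> gap C x = g.
Proof.
case=> /andP[g0 gn] lg H; rewrite -(prednK g0); congr S; apply: find_iota; first by lia.
  by move=> j jg; apply: H; lia.
by move=> _; rewrite prednK.
Qed.

Lemma frontP C x : is_front C x (gap C x) (front C x).
Proof.
rewrite /front; set P := fun j => busy (cf C (pos x j)); set g := gap C x.
have le : find P (iota 0 g) <= g by rewrite -[X in _ <= X](size_iota 0 g) find_size.
split=> //.
  move=> j jf; have := before_find 0 jf; rewrite nth_iota ?add0n; last by lia.
  by rewrite /P => ->.
move=> lt; have hP : has P (iota 0 g) by rewrite has_find size_iota.
by have := nth_find 0 hP; rewrite nth_iota ?add0n.
Qed.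

Lemma front_uniq C x k : is_front C x (gap C x) k -> front C x = k.
Proof. by case=> kg H Hk; apply: find_iota. Qed.

Lemma waitE C x g k : is_gap C x g -> is_front C x g k ->
  wait C x = delay g k (0 < bu (cf C (pos x k))).
Proof.
move=> /gap_uniq gE kP; rewrite /wait gE.
by rewrite (front_uniq (k := k)) // gE.
Qed.

Lemma armedP C x g : is_gap C x g -> reflect
  ((exists2 j, j < g & bu (cf C (pos x j)) = 2) /\
   (forall j, j < g -> bu (cf C (pos x j)) <> 1)) (armed C x).
Proof.
move=> gP; have gE := gap_uniq gP; have [/andP[g0 gn] _ _] := gP.
apply: (iffP andP); rewrite gE.
  case=> /existsP[j /andP[jg /eqP b]] /forallP H; split; first by exists j.
  move=> i ig; have := H (Ordinal (leq_trans ig gn)); rewrite /= ig /=.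
  by move/eqP.
case=> -[j jg b] H; split.
  by apply/existsP; exists (Ordinal (leq_trans jg gn)); rewrite /= jg b.
by apply/forallP=> i; apply/implyP => /H/eqP.
Qed.

Lemma iter_ordS_inj k : injective (fun x : 'I_n => pos x k).
Proof.
elim: k => [|k IH] x y //=; rewrite !posS => /(@ordS_injective n); exact: IH.
Qed.

Lemma gap_disjoint C x y a b : ld (cf C x) -> ld (cf C y) ->
  a < gap C x -> b < gap C y -> pos x a = pos y b -> x = y /\ a = b.
Proof.
wlog le : x y a b / a <= b.
  move=> H lx ly ha hb e; case: (leqP a b) => h; first exact: H.
  by have [] := H y x b a (ltnW h) ly lx hb ha (esym e).
move=> lx ly ha hb e.
have ex : x = pos y (b - a).
  by apply: (@iter_ordS_inj a); rewrite -posD subnK.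
case: (posnP (b - a)) => h; first by split; [rewrite ex h | lia].
have [_ _ H] := gapP ly; have := H (b - a); rewrite -ex lx => /(_ ltac:(lia)).
by [].
Qed.

Lemma next_inj C x y : ld (cf C x) -> ld (cf C y) -> next C x = next C y -> x = y.
Proof.
move=> lx ly; rewrite /next /gap !posS => /(@ordS_injective n) e.
by have [] := @gap_disjoint C x y _ _ lx ly (ltnSn _) (ltnSn _) e.
Qed.

Lemma next_ld C x : ld (cf C x) -> ld (cf C (next C x)).
Proof. by move=> lx; have [] := gapP lx. Qed.

Lemma gap_gt0 C x : 0 < gap C x. Proof. by []. Qed.

Lemma gap_ltn C x : ld (cf C x) -> next C x <> x -> gap C x < n.
Proof.
move=> lx ne; have [/andP[_ le] _ _] := gapP lx.
case: (ltngtP (gap C x) n) => // h; first by lia.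
by case: ne; rewrite /next h posn.
Qed.

Lemma next_neq C x : ld (cf C x) -> #|leaders C| != 1 -> next C x <> x.
Proof.
move=> lx /eqP c1 e; apply: c1; apply/eqP/cards1P; exists x.
apply/setP => y; rewrite !inE; apply/idP/eqP => [ly|->//].
have [j jn ej] := posP n_gt1 x y.
have gn : gap C x = n.
  have [/andP[_ le] _ _] := gapP lx.
  case: (ltngtP (gap C x) n) => // h; last by lia.
  by have := @pos_inj n n_gt1 x (gap C x) 0 h n_gt0 e.
case: (posnP j) => j0; first by rewrite ej j0.
by have [_ _ H] := gapP lx; have := H j; rewrite -ej ly gn => /(_ ltac:(lia)).
Qed.

Lemma tidy_quiet C x j : tidy C -> ld (cf C x) -> j < gap C x -> 0 < bu (cf C (pos x j)) ->
  forall i : nat, i <= j -> ~~ sg (cf C (pos x i)).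
Proof.
case/andP=> _ /forallP H lx jg b.
have /inzP[w [k [kn e z]]] := implyP (H (pos x j)) b.
have lw : ld (cf C w) by have := Qclean_ld (z 0 isT); rewrite pos0.
have kg : k < gap C w.
  have [/andP[g0 _] lg _] := gapP lw; rewrite ltnNge; apply/negP => le.
  by have := Qclean_ld (z _ le); rewrite lg gtn_eqF.
have [<- <-] := gap_disjoint lw lx kg jg (esym e).
by move=> i ik; case/andP: (z i ik).
Qed.

Lemma front_le C x : front C x <= gap C x. Proof. by case: (frontP C x). Qed.

Lemma wait_le C x : wait C x <= 2 * gap C x - 1.
Proof.
have kle := front_le C x; have g0 := gap_gt0 C x; rewrite /wait /delay.
by case: eqP => _; [|case: ifP => _]; lia.
Qed.

Section Transition.
Variables (C : config N n) (x : 'I_n).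
Hypotheses (tC : tidy C) (lx : ld (cf C x)) (nx : next C x <> x).
Local Notation g := (gap C x).
Local Notation k := (front C x).
Local Notation px := (@ord_pred n x).
Let cC : calm C. Proof. by case/andP: tC. Qed.
Let g_lt : g < n. Proof. exact: gap_ltn. Qed.
Let g_gt0 : 0 < g. Proof. by []. Qed.

Definition dec_idx : nat :=
  if k == g then g.-1 else if 0 < bu (cf C (pos x k)) then k else k.-1.
Definition dec_arc : 'I_n := pos x dec_idx.

Lemma gap_nl j : 0 < j < g -> ld (cf C (pos x j)) = false.
Proof. by have [_ _ H] := gapP lx; move=> /H/negbTE. Qed.

Lemma front_idle j : j < k -> bu (cf C (pos x j)) = 0 /\ sg (cf C (pos x j)) = false.
Proof.
case: (frontP C x) => _ H _ /H; rewrite negb_or -eqn0Ngt => /andP[/eqP -> /negbTE].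
by [].
Qed.

Lemma front_busy : k < g -> busy (cf C (pos x k)).
Proof. by case: (frontP C x). Qed.

Lemma front_bullet : k < g -> 0 < bu (cf C (pos x k)) -> sg (cf C (pos x k)) = false.
Proof.
move=> kg b; have H := tidy_quiet tC lx kg b; apply/negbTE.
exact: (H k (leqnn k)).
Qed.

Lemma front_signal : k < g -> bu (cf C (pos x k)) = 0 -> sg (cf C (pos x k)).
Proof. by move=> kg b; have := front_busy kg; rewrite /busy b. Qed.

Lemma wait0 : (wait C x == 0) = sg (cf C x).
Proof.
rewrite /wait /delay; have kle := front_le C x.
case: (k =P g) => [kg|/eqP kg].
  have : 0 < k by rewrite kg.
  by move=> /front_idle[_]; rewrite pos0 => ->; apply/eqP.
have kl : k < g by rewrite ltn_neqAle kg.
case: (posnP (bu (cf C (pos x k)))) => b; last first.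
  have := tidy_quiet tC lx kl b (leq0n _); rewrite pos0 => /negbTE->.
  by apply/eqP; lia.
have sk := front_signal kl b.
case: (posnP k) sk => [->|k0 _]; first by rewrite pos0 => ->.
by have [_] := front_idle k0; rewrite pos0 => ->.
Qed.

Lemma sg_no_bullet j : sg (cf C x) -> j < g -> bu (cf C (pos x j)) = 0.
Proof.
move=> sx jg; case: (posnP (bu (cf C (pos x j)))) => // b.
by have := tidy_quiet tC lx jg b (leq0n _); rewrite pos0 sx.
Qed.

Lemma dec_idx_lt : dec_idx < g.
Proof.
have := front_le C x; rewrite /dec_idx; case: eqP => [_ _|/eqP h le]; first by lia.
by case: ifP => _; lia.
Qed.

Lemma dec_idx_last : 0 < wait C x -> (dec_idx == g.-1) = (wait C x == g).
Proof.
move=> w0; have := front_le C x; move: w0; rewrite /wait /delay /dec_idx.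
case: eqP => [_ _ _|/eqP h w0 le]; first by rewrite !eqxx.
by case: ifP w0 => _ w0; lia.
Qed.

Lemma armed_bullet : armed C x -> k < g /\ bu (cf C (pos x k)) = 2.
Proof.
move=> /(armedP (gapP lx))[[j jg b2] no1].
have kj : k <= j.
  rewrite leqNgt; apply/negP => /front_idle[]; by rewrite b2.
have kg : k < g by lia.
split=> //; have := no1 k kg; have := bu_cf C (pos x k).
case: (posnP (bu (cf C (pos x k)))) => [b0|]; last by lia.
have b : 0 < bu (cf C (pos x j)) by rewrite b2.
by have := tidy_quiet tC lx jg b kj; rewrite front_signal.
Qed.

Lemma pos_gap_px j : j < g -> pos x j <> px.
Proof.
move=> jg E; have : pos x j.+1 = pos x n by rewrite posS E ord_predK posn.
rewrite posn => /(@pos_inj n n_gt1 x j.+1 0); lia.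
Qed.

Lemma pos_gap_inj a b : a <= g -> b <= g -> pos x a = pos x b -> a = b.
Proof. by move=> ag bg; apply: pos_inj; lia. Qed.

Section OneStep.
Variable e : 'I_n.
Hypothesis nk : ordS e = x \/ ordS e = next C x -> ~~ kills (cf C e) (cf C (ordS e)).
Local Notation C' := (step e C).

Lemma ld_step u : u <> ordS e \/ ~~ kills (cf C e) (cf C (ordS e)) ->
  ld (cf C' u) = ld (cf C u).
Proof.
case: (stepP n_gt1 leNn) => [->|-> _ [//|nk']|] //.
rewrite /resp; case: ifP => [_|/negbT lr] /=; first exact: nk'.
by rewrite creates_lt //; apply: calm_newdi.
Qed.

Lemma gap_step_is : is_gap C' x g.
Proof.
have [h1 h2 h3] := gapP lx; split=> //.
  rewrite ld_step //; case: (eqVneq (ordS e) (next C x)) => h.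
    by right; apply: nk; right.
  by left; move=> E; rewrite -E eqxx in h.
move=> j jg; have := h3 j jg; have [<-|ne] := eqVneq (ordS e) (pos x j).
  move=> nl; rewrite cf_step_r // /resp (negbTE nl) creates_lt //.
  exact: calm_newdi.
by rewrite ld_step //; left; apply/eqP; rewrite eq_sym.
Qed.

Lemma gap_step : gap C' x = g. Proof. exact: gap_uniq gap_step_is. Qed.
Lemma next_step : next C' x = next C x. Proof. by rewrite /next gap_step. Qed.

Lemma same_data : (forall j, j < g -> cf C' (pos x j) = cf C (pos x j)) ->
  [/\ wait C' x = wait C x, armed C' x = armed C x & sh (cf C' x) = sh (cf C x)].
Proof.
move=> H; split; last by have := H 0 g_gt0; rewrite pos0 => ->.
  have [h1 h2 h3] := frontP C x.
  rewrite (waitE gap_step_is (k := k)); last first.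
    split=> // [j jk|kg]; rewrite H //; [exact: h2 | by lia | exact: h3].
  rewrite /wait /delay; case: eqP => // kg; rewrite H //; lia.
rewrite /armed gap_step; congr (_ && _).
  by apply: eq_existsb => j; case: ltnP => //= jg; rewrite H.
by apply: eq_forallb => j; case: ltnP => //= jg; rewrite H.
Qed.

Lemma step_far : e <> px -> (forall j, j < g -> e <> pos x j) ->
  [/\ wait C' x = wait C x, armed C' x = armed C x & sh (cf C' x) = sh (cf C x)].
Proof.
move=> ne nj; apply: same_data => j jg; apply: cf_step_o.
  by move=> E; apply: (nj j).
case: j jg => [|j] jg E; first by apply: ne; rewrite -[e](@ordSK n) -E.
by apply: (nj j); [lia | apply: (@ordS_injective n); rewrite -E].
Qed.

Lemma px_far j : e = px -> 0 < j < g -> cf C' (pos x j) = cf C (pos x j).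
Proof.
move=> ep /andP[j0 jg]; apply: cf_step_o; first by rewrite ep; apply: pos_gap_px.
rewrite ep ord_predK => E; have := @pos_gap_inj j 0 (ltnW jg) (leq0n _) E; lia.
Qed.

Lemma px_x : e = px -> cf C' x =
  Agent true (if sg (cf C x) then 1 else bu (cf C x)) (sh (cf C x) && ~~ sg (cf C x)) false 0.
Proof.
move=> ep; have ex : ordS e = x by rewrite ep ord_predK.
by rewrite -{1}ex cf_step_r // /resp ex lx -ex nk //; left.
Qed.

Lemma step_pred_quiet : e = px -> sg (cf C x) = false ->
  [/\ wait C' x = wait C x, armed C' x = armed C x & sh (cf C' x) = sh (cf C x)].
Proof.
move=> ep sx; have xE := px_x ep; rewrite sx /= andbT in xE.
have bE j : j < g -> bu (cf C' (pos x j)) = bu (cf C (pos x j)) /\ sg (cf C' (pos x j)) = sg (cf C (pos x j)).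
  case: (posnP j) => [->|j0] jg; first by rewrite pos0 xE sx.
  by rewrite px_far // j0.
split; last by rewrite xE.
  have [h1 h2 h3] := frontP C x.
  rewrite (waitE gap_step_is (k := k)); last first.
    split=> // [j jk|kg].
      by have [b1 b2] := bE j ltac:(lia); rewrite /busy b1 b2; apply: h2.
    by have [b1 b2] := bE k kg; rewrite /busy b1 b2; apply: h3.
  rewrite /wait /delay; case: eqP => // kg; have [-> _] := bE k ltac:(lia); by [].
rewrite /armed gap_step; congr (_ && _).
  by apply: eq_existsb => j; case: ltnP => //= jg; have [-> _] := bE _ jg.
by apply: eq_forallb => j; case: ltnP => //= jg; have [-> _] := bE _ jg.
Qed.

Lemma step_pred_signal : e = px -> sg (cf C x) ->
  wait C' x = 2 * g - 1 /\ sh (cf C' x) = false.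
Proof.
move=> ep sx; have xE := px_x ep; rewrite sx /= andbF in xE; split; last by rewrite xE.
rewrite (waitE gap_step_is (k := 0)); first by rewrite pos0 xE /delay /=; lia.
by split=> // _; rewrite pos0 xE.
Qed.

Section InGap.
Variable a : nat.
Hypotheses (ag : a < g) (ea : e = pos x a).
Local Notation l := (cf C (pos x a)).
Local Notation r := (cf C (pos x a.+1)).

Let eS : ordS e = pos x a.+1. Proof. by rewrite ea. Qed.

Lemma in_l : cf C' (pos x a) = init N l r.
Proof. by rewrite -{1}ea cf_step_l // eS ea. Qed.

Lemma in_r : cf C' (pos x a.+1) = resp N l r.
Proof. by rewrite -{1}eS cf_step_r // eS ea. Qed.

Lemma in_o j : j < g -> j <> a -> j <> a.+1 -> cf C' (pos x j) = cf C (pos x j).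
Proof.
move=> jg ja ja1; apply: cf_step_o.
  by rewrite ea => E; apply: ja; apply: pos_gap_inj E; lia.
by rewrite eS => E; apply: ja1; apply: pos_gap_inj E; lia.
Qed.

Lemma in_r_nl : a.+1 < g ->
  resp N l r = Agent false (if bu r == 0 then fire l else bu r) (sh r)
         (sg r && (fire l == 0)) (newdi N l r).
Proof.
move=> a1; have lr := gap_nl (j := a.+1) ltac:(lia).
rewrite /resp lr creates_lt //.
by have := @calm_newdi N n n_gt1 leNn C e cC; rewrite eS ea lr; apply.
Qed.

Lemma in_r_ld : a.+1 = g -> ld (resp N l r) /\ sg (resp N l r) = false.
Proof.
move=> a1; have lr : ld r by rewrite a1; apply: next_ld.
have nk' : ~~ kills l r.
  by have := nk; rewrite eS ea; apply; right; rewrite a1.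
by rewrite /resp lr /= nk'.
Qed.

Lemma fire_l : sg (cf C x) = false -> fire l = bu l.
Proof.
move=> sx; rewrite /fire; case: (posnP a) => [->|a0]; first by rewrite pos0 sx andbF.
by rewrite gap_nl //; lia.
Qed.

Lemma in_sh : sg (cf C x) = false -> sh (cf C' x) = sh (cf C x).
Proof.
move=> sx; case: (posnP a) => [a0|a0].
  by have := in_l; rewrite a0 pos0 => ->; rewrite /= sx andbF.
by rewrite -[x in cf C' x]pos0 in_o ?pos0 //; lia.
Qed.

Lemma in_front k' : is_front C' x g k' ->
  wait C' x = delay g k' (0 < bu (cf C' (pos x k'))).
Proof. exact: waitE gap_step_is. Qed.

Lemma in_move : sg (cf C x) = false ->
  wait C' x = if a == dec_idx then (wait C x).-1 else wait C x.
Proof.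
move=> sx; have fl := fire_l sx.
have wE : wait C x = delay g k (0 < bu (cf C (pos x k))) by [].
have kle := front_le C x; have fb := front_busy; have fbu := front_bullet; have fs := front_signal.
have idle_o j : j < k -> j <> a -> j <> a.+1 -> ~~ busy (cf C' (pos x j)).
  by move=> jk ja ja1; rewrite in_o ?/busy //; [have [-> ->] := front_idle jk | lia].
have k0 : k < g -> bu (cf C (pos x k)) = 0 -> 0 < k.
  move=> kg b0; case: (posnP k) => // k0; have := fs kg b0.
  by rewrite k0 pos0 sx.
have [lt|le] := ltnP a k; last first.
  have idleA j : j < k -> ~~ busy (cf C' (pos x j)) by move=> jk; apply: idle_o => //; lia.
  have kg : k < g by lia.
  have [eq|ne] := eqVneq a k; last first.
    rewrite (in_front (k' := k)); last by split=> // _; rewrite in_o; [apply: fb | lia..].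
    rewrite in_o -?wE; [|lia..].
    by case: eqP => // ad; move: ne le; rewrite ad /dec_idx; case: ifP => [|_]; [|case: ifP => _]; lia.
  have ek : pos x a = pos x k by rewrite eq.
  case: (posnP (bu (cf C (pos x k)))) => b.
    rewrite (in_front (k' := k)); last first.
      split=> // _; rewrite -ek in_l /busy /= ek (fs kg b).
      by rewrite gap_nl ?orbT //; have := k0 kg b; lia.
    rewrite -ek in_l /= wE b /= /dec_idx b /=.
    have -> : (k == g) = false by lia.
    by have -> : (a == k.-1) = false by have := k0 kg b; lia.
  have sl := fbu kg b.
  have -> : (a == dec_idx) by rewrite /dec_idx b; case: (k =P g); lia.
  rewrite wE /delay b; have -> : (k == g) = false by lia.
  have [a1|a1] := ltnP a.+1 g.
    have rE := in_r_nl a1.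
    have br : 0 < bu (resp N l r).
      by rewrite rE /= fl ek; case: eqP => // /eqP; rewrite lt0n.
    have sr : sg (resp N l r) = false by rewrite rE /= fl ek eqn0Ngt b andbF.
    rewrite (in_front (k' := k.+1)); last first.
      rewrite -eq; split; [by lia | | by rewrite in_r /busy br].
      move=> j; rewrite ltnS leq_eqVlt => /orP[/eqP->|jk]; last by apply: idleA; lia.
      by rewrite in_l /busy /= sr rE /= ek sl.
    rewrite -eq in_r br /delay; have -> : (a.+1 == g) = false by lia.
    by lia.
  have ag1 : a.+1 = g by lia.
  have [lr' sr'] := in_r_ld ag1.
  rewrite (in_front (k' := k)); last by split=> // _; rewrite -ek in_l /busy /= lr' !orbT.
  rewrite -ek in_l /delay /=; have -> : (k == g) = false by lia.
  by lia.
have [bl sl] := front_idle lt.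
have [eq|ne] := eqVneq a.+1 k; last first.
  have a1 : a.+1 < k by lia.
  have rE := in_r_nl (leq_trans a1 kle).
  have [br sr] := front_idle a1.
  have idleA j : j < k -> ~~ busy (cf C' (pos x j)).
    move=> jk; have [->|ja] := eqVneq j a; first by rewrite in_l /busy /= sl rE /= sr.
    have [->|ja1] := eqVneq j a.+1; first by rewrite in_r rE /busy /= br fl bl sr.
    by apply: idle_o => //; apply/eqP.
  have nd : (a == dec_idx) = false by rewrite /dec_idx; case: ifP => _; [|case: ifP => _]; lia.
  rewrite nd; case: (ltngtP k g) kle => // kg _.
    rewrite (in_front (k' := k)); last by split=> // [|_]; [lia | rewrite in_o; [apply: fb | lia..]].
    by rewrite in_o //; lia.
  rewrite (in_front (k' := k)); last by split=> //; [rewrite kg | lia].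
  by rewrite wE /delay kg eqxx.
have idleA j : j < a -> ~~ busy (cf C' (pos x j)) by move=> jk; apply: idle_o => //; lia.
case: (ltngtP k g) kle => // kg _; last first.
  have ag1 : a.+1 = g by lia.
  have [lr' sr'] := in_r_ld ag1.
  rewrite (in_front (k' := a)); last first.
    by split=> // [|_]; [lia | rewrite in_l /busy /= lr' !orbT].
  have -> : (a == dec_idx) by rewrite /dec_idx kg eqxx; lia.
  by rewrite in_l wE /delay kg eqxx (ltn_eqF ag) -ag1.
have a1 : a.+1 < g by lia.
have rE := in_r_nl a1.
have er : pos x a.+1 = pos x k by rewrite eq.
case: (posnP (bu (cf C (pos x k)))) => b.
  have sr := fs kg b.
  rewrite (in_front (k' := a)); last first.
    by split=> // [|_]; [lia | rewrite in_l /busy /= rE /= er sr fl bl orbT].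
  have kg' : (k == g) = false by lia.
  rewrite in_l wE /delay /dec_idx b kg' /= -eq /= eqxx.
  by have -> : (a == g) = false by lia.
have sr := fbu kg b.
have nd : (a == dec_idx) = false by rewrite /dec_idx b; case: ifP => _; lia.
rewrite nd (in_front (k' := k)).
  by rewrite -er in_r rE /= er eqn0Ngt b /= wE b.
split=> //; first by lia.
  move=> j; rewrite -eq ltnS leq_eqVlt => /orP[/eqP->|jk]; last by apply: idleA.
  by rewrite in_l /busy /= sl rE /= er sr.
by move=> _; rewrite -er in_r rE /busy /= er eqn0Ngt b /= b.
Qed.

Lemma in_armed : sg (cf C x) = false -> armed C x -> g <= wait C' x -> armed C' x.
Proof.
move=> sx ar; have [kg b2] := armed_bullet ar; have fl := fire_l sx.
have [_ no1] := armedP (gapP lx) ar.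
have no1' j : j < g -> bu (cf C' (pos x j)) <> 1.
  move=> jg; have [->|ja] := eqVneq j a; first by rewrite in_l.
  have [ej|ja1] := eqVneq j a.+1; last by rewrite in_o; [apply: no1 | | apply/eqP..].
  rewrite ej in jg *; rewrite in_r in_r_nl //= fl; case: ifP => _; apply: no1 => //; lia.
move=> gw.
have [k'le idl bsy] := frontP C' x; rewrite gap_step in k'le bsy.
set k' := front C' x in k'le idl bsy *.
have wE : wait C' x = delay g k' (0 < bu (cf C' (pos x k'))) by rewrite /wait gap_step.
apply/(armedP gap_step_is); split=> //.
have two j : j < g -> 0 < bu (cf C' (pos x j)) -> bu (cf C' (pos x j)) = 2.
  move=> jg b; have := no1' j jg; have := bu_cf C' (pos x j); lia.
have [ek|nek] := eqVneq a k; last first.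
  exists k => //; apply: two => //.
  have [ek|nek2] := eqVneq k a.+1.
    by rewrite ek in_r in_r_nl /= -?ek // b2.
  by rewrite in_o ?b2 //; [apply/eqP; rewrite eq_sym | apply/eqP].
have [a1|a1] := ltnP a.+1 g.
  exists a.+1 => //; apply: two => //; rewrite in_r in_r_nl //= fl ek b2.
  by case: eqP => // /eqP; rewrite lt0n.
have ag1 : a.+1 = g by lia.
have := in_move sx; have -> : a == dec_idx by rewrite /dec_idx b2 -ek (ltn_eqF ag) /= eqxx.
rewrite {2}/wait /delay b2 /=; have -> : (k == g) = false by lia.
lia.
Qed.

Lemma in_signal_fire : sg (cf C x) -> a = 0 ->
  [/\ wait C' x = 2 * g - 2, 1 < g -> armed C' x & sh (cf C' x)].
Proof.
move=> sx a0; have nb j : j < g -> bu (cf C (pos x j)) = 0 by apply: sg_no_bullet.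
have xl : cf C' x = init N l r by rewrite -in_l a0 pos0.
have fl : fire l = 2 by rewrite /fire a0 pos0 lx sx.
have shx : sh (cf C' x) by rewrite xl /= a0 pos0 lx sx.
case: (ltngtP 1 g) => [g1|g1|g1]; last first.
- have ag1 : a.+1 = g by rewrite a0 -g1.
  have [lr' _] := in_r_ld ag1.
  split=> //; rewrite (in_front (k' := 0)); last by split=> // _; rewrite pos0 xl /busy /= lr' !orbT.
  by rewrite -g1 /delay /= pos0 xl.
- by lia.
have a1 : a.+1 < g by lia.
have rE := in_r_nl a1.
have b1 : bu (cf C' (pos x 1)) = 2 by have := in_r; rewrite {1}a0 => ->; rewrite rE /= nb // fl.
split=> // [|_].
  rewrite (in_front (k' := 1)).
    by rewrite b1 /delay (ltn_eqF g1) -subnDA.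
  split=> // [[|//] _|_]; last by rewrite /busy b1.
  by rewrite pos0 xl /busy /= rE /= fl andbF a0 pos0 lx sx.
apply/(armedP gap_step_is); split; first by exists 1.
move=> j jg; have [->|j0] := eqVneq j 0; first by rewrite pos0 xl.
have [->|j1] := eqVneq j 1; first by rewrite b1.
by rewrite in_o ?nb //; apply/eqP; rewrite a0.
Qed.

Lemma in_signal_wait : sg (cf C x) -> 0 < a -> wait C' x = 0 /\ sh (cf C' x) = sh (cf C x).
Proof.
move=> sx a0; have xE : cf C' x = cf C x by rewrite -[x in cf C' x]pos0 in_o ?pos0 //; lia.
split; last by rewrite xE.
rewrite (in_front (k' := 0)); last by split=> // _; rewrite pos0 xE /busy sx orbT.
by rewrite pos0 xE -[x in cf C x]pos0 sg_no_bullet // /delay.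
Qed.

End InGap.

Lemma arc_cases : [\/ e = px, exists2 a, a < g & e = pos x a
  | e <> px /\ (forall j, j < g -> e <> pos x j)].
Proof.
have [->|ne] := eqVneq e px; first by constructor 1.
have [j jn ej] := posP n_gt1 x e.
have [jg|jg] := ltnP j g; first by constructor 2; exists j.
constructor 3; split; first exact/eqP.
by move=> i ig E; have := @pos_inj n n_gt1 x j i jn ltac:(lia); rewrite -ej => /(_ E); lia.
Qed.

Lemma data_move : 0 < wait C x ->
  [/\ sh (cf C' x) = sh (cf C x),
      wait C' x = (if e == dec_arc then (wait C x).-1 else wait C x)
    & g <= wait C' x -> armed C x -> armed C' x].
Proof.
move=> w0; have sx : sg (cf C x) = false by rewrite -wait0 gtn_eqF.
case: arc_cases => [ep|[a ag ea]|[ne nj]].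
- have [h1 h2 h3] := step_pred_quiet ep sx.
  have -> : (e == dec_arc) = false.
    by apply/eqP => E; apply: (pos_gap_px dec_idx_lt); rewrite -ep E.
  by split=> //; rewrite h2.
- split; first exact: in_sh ea sx.
    rewrite (in_move ag ea sx) ea; congr (if _ then _ else _).
    apply/eqP/eqP => [->//|E].
    by apply: pos_gap_inj E; [lia | have := dec_idx_lt; lia].
  by move=> gw ar; apply: in_armed ag ea sx ar gw.
- have [h1 h2 h3] := step_far ne nj.
  have -> : (e == dec_arc) = false by apply/eqP; apply: nj; apply: dec_idx_lt.
  by split=> //; rewrite h2.
Qed.

Lemma data_toss : wait C x = 0 ->
  if e == x then [/\ sh (cf C' x), 1 < g -> armed C' x & wait C' x = 2 * g - 2]
  else if e == px then ~~ sh (cf C' x) /\ wait C' x = 2 * g - 1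
  else sh (cf C' x) = sh (cf C x) /\ wait C' x = 0.
Proof.
move=> w0; have sx : sg (cf C x) by rewrite -wait0 w0.
have pxx : (px == x) = false.
  by apply/eqP => E; apply: (@pos_gap_px 0 g_gt0); rewrite pos0.
case: arc_cases => [ep|[a ag ea]|[ne nj]].
- by rewrite ep pxx eqxx -ep; have [-> ->] := step_pred_signal ep sx.
- case: (posnP a) => a0.
    have -> : e == x by rewrite ea a0.
    by have [] := in_signal_fire ag ea sx a0.
  have -> : (e == x) = false.
    by apply/eqP; rewrite ea => E; have := @pos_gap_inj a 0 (ltnW ag) (leq0n _) E; lia.
  have -> : (e == px) = false by apply/eqP; rewrite ea; apply: pos_gap_px.
  by have [-> ->] := in_signal_wait ag ea sx a0.
- have [h1 h2 h3] := step_far ne nj.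
  have -> : (e == x) = false by apply/eqP; apply: (nj 0 g_gt0).
  have -> : (e == px) = false by apply/eqP.
  by rewrite h1 h3 w0.
Qed.

End OneStep.
End Transition.
End Gaps.
(** * Elimination of the surplus leaders *)

Section Elimination.
Variables (R : realFieldType) (N n : nat).
Hypothesis (n_gt1 : 1 < n) (leNn : n <= N).
Implicit Types (C : config N n) (e i u v w x y : 'I_n).
Let n_gt0 : 0 < n. Proof. exact: ltnW. Qed.
Local Notation killing C e := (kills (cf C e) (cf C (ordS e))).

Definition pair_pot C u : R :=
  local_pot R (gap C u) (gap C (next C u)) (sh (cf C (next C u))) (armed C (next C u))
     (wait C (next C u)) (armed C u) (wait C u).

Definition touched C u e : bool := killing C e &&
  [|| ordS e == u, ordS e == next C u | ordS e == next C (next C u)].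

Lemma pair_pot_bound C u : (- (3/2) <= pair_pot C u <= 3/2)%R.
Proof. by apply: local_pot_bound => //; apply: wait_le. Qed.

Section Pair.
Variables (C : config N n) (u : 'I_n).
Hypotheses (tC : tidy C) (lu : ld (cf C u)) (many : #|leaders C| != 1).
Local Notation v := (next C u).
Local Notation gu := (gap C u).
Local Notation gv := (gap C v).

Let lv : ld (cf C v). Proof. exact: next_ld. Qed.
Let nu : v <> u. Proof. exact: next_neq. Qed.
Let nv : next C v <> v. Proof. exact: next_neq. Qed.

Let nk_u e : ~~ touched C u e -> ordS e = u \/ ordS e = v -> ~~ killing C e.
Proof. by move=> nt E; apply: contra nt => k; rewrite /touched k /=; case: E => ->; rewrite eqxx ?orbT. Qed.

Let nk_v e : ~~ touched C u e -> ordS e = v \/ ordS e = next C v -> ~~ killing C e.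
Proof. by move=> nt E; apply: contra nt => k; rewrite /touched k /=; case: E => ->; rewrite eqxx ?orbT. Qed.

Lemma pair_pot_step e : ~~ touched C u e -> pair_pot (step e C) u =
  local_pot R gu gv (sh (cf (step e C) v)) (armed (step e C) v) (wait (step e C) v)
    (armed (step e C) u) (wait (step e C) u).
Proof.
move=> nt; rewrite /pair_pot (next_step n_gt1 leNn tC lu (nk_u nt)).
by rewrite (gap_step n_gt1 leNn tC lu (nk_u nt)) (gap_step n_gt1 leNn tC lv (nk_v nt)).
Qed.

Let pvE : ord_pred v = pos u gu.-1.
Proof. by apply: (@ordS_injective n); rewrite ord_predK -posS prednK. Qed.

Let in_gap_px x j : ld (cf C x) -> j < gap C x -> next C x <> x -> pos x j <> ord_pred x.
Proof. by move=> lx jg nx; apply: (pos_gap_px n_gt1 leNn tC lx nx). Qed.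

Let last_bullet x : ld (cf C x) -> next C x <> x -> wait C x = gap C x -> armed C x ->
  fire (cf C (pos x (gap C x).-1)) = 2.
Proof.
move=> lx nx w ar; have [kg b2] := armed_bullet n_gt1 leNn tC lx nx ar.
have ek : front C x = (gap C x).-1.
  by move: w kg; rewrite /wait /delay b2; move: (gap C x) (front C x) => G K w kg; rewrite (ltn_eqF kg) /= in w; lia.
rewrite -ek /fire b2; have b : 0 < bu (cf C (pos x (front C x))) by rewrite b2.
by have /negbTE-> := tidy_quiet n_gt1 leNn tC lx kg b (leqnn _); rewrite andbF.
Qed.

Let sg_wait0 x : ld (cf C x) -> next C x <> x -> wait C x = 0 -> sg (cf C x).
Proof. by move=> lx nx w; rewrite -(wait0 n_gt1 leNn tC lx nx) w. Qed.

Let unshielded x : ld (cf C x) -> next C x <> x -> ~~ sh (cf C x) \/ wait C x = 0 ->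
  ~~ (sh (cf C x) && ~~ sg (cf C x)).
Proof. by move=> lx nx [/negbTE->|/(sg_wait0 lx nx)->]; rewrite ?andbF. Qed.

Lemma pair_drift : (\sum_e (if touched C u e then -14 else pair_pot (step e C) u - pair_pot C u)
   <= - drift_unit R gu gv)%R.
Proof.
have neq_pred x : (x == ord_pred x) = false.
  by apply/eqP => E; have := ordS_neq n_gt1 (ord_pred x); rewrite ord_predK -E eqxx.
have dl x := @dec_idx_lt N n n_gt1 leNn C x tC.
have gap0 x : 0 < gap C x by [].
rewrite (eq_bigr (delta R gu gv (sh (cf C v)) (armed C v) (armed C u) (wait C v) (wait C u)
   (touched C u) (fun e => sh (cf (step e C) v)) (fun e => armed (step e C) v)
   (fun e => armed (step e C) u) (fun e => wait (step e C) v) (fun e => wait (step e C) u))); last first.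
  move=> e _; rewrite /delta; case: ifP => // /negbT nt.
  by rewrite pair_pot_step.
apply: (@local_drift R n gu gv _ _ _ _ _ _ _ _ _ _ _ _ _ u (ord_pred u) v (ord_pred v)
   (dec_arc C u) (dec_arc C v)) => //.
- exact: wait_le.
- exact: wait_le.
- move=> e nt; apply: leq_trans (wait_le n_gt1 leNn _ _) _.
  by rewrite (gap_step n_gt1 leNn tC lv (nk_v nt)).
- move=> e nt; apply: leq_trans (wait_le n_gt1 leNn _ _) _.
  by rewrite (gap_step n_gt1 leNn tC lu (nk_u nt)).
- by move=> w0 e nt; apply: (data_move n_gt1 leNn tC lv nv (nk_v nt)).
- by move=> w0 e nt; apply: (data_toss n_gt1 leNn tC lv nv (nk_v nt)).
- by move=> w0 e nt; have [] := data_move n_gt1 leNn tC lu nu (nk_u nt) w0.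
- move=> w0 e nt; have := data_toss n_gt1 leNn tC lu nu (nk_u nt) w0.
  by case: ifP => _; [case | case: ifP => _ []].
- by rewrite neq_pred.
- by rewrite neq_pred.
- rewrite pvE; apply/eqP/eqP => [E|->//].
  have h := @pos_gap_inj N n n_gt1 leNn C u tC lu nu 0 gu.-1 isT (leq_pred _) E.
  by rewrite -(prednK (gap0 u)) -h.
- by rewrite eq_sym; apply/eqP.
- by apply/eqP => /(can_inj (@ord_predK n)) E; apply: nu.
- move=> w0; have d := dl v lv nv; split.
  + apply/eqP => E; have [] := @gap_disjoint N n n_gt1 leNn C v u _ 0 lv lu d (gap0 u) E.
    by move=> E2; case: nu.
  + by apply/eqP; apply: in_gap_px.
  + move=> E; apply/eqP; rewrite -(dec_idx_last n_gt1 leNn tC lv nv w0).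
    have E2 : pos v (dec_idx C v).+1 = u by rewrite posS -/(dec_arc C v) E ord_predK.
    have [le|le] := leqP gv (dec_idx C v).+1; first by apply/eqP; move: le d; case: (gap C v) => // G; lia.
    by have := gap_nl n_gt1 leNn lv (j := (dec_idx C v).+1) le; rewrite E2 lu.
- move=> w0; have d := dl u lu nu; split.
  + apply/eqP => E; have := @pos_gap_inj N n n_gt1 leNn C u tC lu nu _ gu (ltnW d) (leqnn _) E.
    by lia.
  + by apply/eqP; apply: in_gap_px.
  + rewrite -(dec_idx_last n_gt1 leNn tC lu nu w0) pvE; apply/eqP/eqP => [E|E]; last by rewrite /dec_arc E.
    exact: (@pos_gap_inj N n n_gt1 leNn C u tC lu nu _ _ (ltnW d) (leq_pred _) E).
- move=> _ _; apply/eqP => E.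
  have [] := @gap_disjoint N n n_gt1 leNn C u v _ _ lu lv (dl u lu nu) (dl v lv nv) E.
  by move=> E2; case: nu.
- move=> w ar g1 un; rewrite /touched ord_predK eqxx orbT andbT /kills lv pvE.
  by rewrite (last_bullet lu nu w ar) /=; apply: unshielded.
- move=> g1 w un; rewrite /touched ord_predK eqxx orbT andbT /kills lv pvE g1 /= pos0.
  by rewrite /fire lu (sg_wait0 lu nu w) /=; apply: unshielded.
- move=> E w0 w ar; rewrite /touched ord_predK eqxx andbT /kills lu.
  have -> : ord_pred u = pos v gv.-1.
    rewrite -E /dec_arc; congr pos; apply/eqP.
    by rewrite (dec_idx_last n_gt1 leNn tC lv nv) w ?eqxx.
  by rewrite (last_bullet lv nv w ar) (sg_wait0 lu nu w0) /= andbF.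
- move=> E w1 w0; rewrite /touched ord_predK eqxx andbT /kills lu -E.
  by rewrite /fire lv (sg_wait0 lv nv w1) (sg_wait0 lu nu w0) /= andbF.
Qed.

End Pair.

Local Open Scope ring_scope.

Definition total C : R := \sum_(u in leaders C) (52 + pair_pot C u).

Lemma leaders_step C e : tidy C ->
  leaders (step e C) = if killing C e then leaders C :\ ordS e else leaders C.
Proof.
move=> tC; apply/setP => x; rewrite !inE.
have -> : (x \in (if killing C e then leaders C :\ ordS e else leaders C)) =
   ld (cf C x) && ~~ (killing C e && (x == ordS e)).
  by case: ifP => _; rewrite !inE /= ?andbT // andbC.
have [/andP[k /eqP ->]|nk] := boolP (killing C e && (x == ordS e)).
  by rewrite andbF cf_step_r // /resp; case/and3P: (k) => -> _ _; rewrite /= k.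
rewrite andbT; apply: (ld_step n_gt1 leNn tC).
case: (eqVneq x (ordS e)) nk => [_|/eqP ne _]; last by left.
by rewrite andbT; right.
Qed.

Lemma sum_unique_le1 (A : {set 'I_n}) (P : pred 'I_n) :
  (forall x y, x \in A -> y \in A -> P x -> P y -> x = y) ->
  \sum_(x in A) (P x)%:R <= 1 :> R.
Proof.
move=> H; rewrite (eq_bigr (fun x => if P x then 1 else 0)); last by move=> x _; case: (P x).
rewrite -big_mkcondr /= sumr_const lern1; apply/card_le1_eqP => x y.
by rewrite !unfold_in => /andP[xA Px] /andP[yA Py]; apply: H.
Qed.

Lemma total_step C e : tidy C ->
  total (step e C) - total C <= \sum_(u in leaders C)
    (if touched C u e then -14 else pair_pot (step e C) u - pair_pot C u).
Proof.
move=> tC; rewrite /total leaders_step //; case: ifP => [k|nk]; last first.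
  rewrite -sumrB; apply: ler_sum => u _; rewrite /touched nk /=; lra.
set y := ordS e.
have yL : y \in leaders C by rewrite inE; case/and3P: k.
rewrite [\sum_(u in leaders C) (52 + _)](big_setD1 y) //= [leRHS](big_setD1 y) //=.
have -> : touched C y e by rewrite /touched k eqxx.
set L := leaders C :\ y.
pose b x : R := (next C x == y)%:R + (next C (next C x) == y)%:R.
have H x : x \in L -> 52 + pair_pot (step e C) x <=
    52 + pair_pot C x + (if touched C x e then -14 else pair_pot (step e C) x - pair_pot C x) + 17 * b x.
  rewrite !inE => /andP[xy lx].
  have b0 : 0 <= b x by rewrite addr_ge0.
  case: ifP => [/andP[_]|_]; last by lra.
  rewrite -/y [y == x]eq_sym (negbTE xy) /= => t.
  have b1 : 1 <= b x by case/orP: t => /eqP E; rewrite /b -E eqxx ?lerDl ?lerDr.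
  have := pair_pot_bound C x; have := pair_pot_bound (step e C) x; lra.
have B : \sum_(x in L) b x <= 2.
  have sub x : x \in L -> ld (cf C x) by rewrite !inE => /andP[].
  rewrite big_split /= -[leRHS](_ : 1 + 1 = _) //; apply: lerD; apply: sum_unique_le1.
    move=> x z /sub lx /sub lz /eqP <- /eqP E; symmetry; exact: next_inj E.
  move=> x z /sub lx /sub lz /eqP <- /eqP E; symmetry.
  by apply: (next_inj n_gt1 leNn lz lx); apply: (next_inj n_gt1 leNn _ _ E); apply: next_ld.
have : \sum_(x in L) (52 + pair_pot (step e C) x) <= \sum_(x in L) (52 + pair_pot C x +
    (if touched C x e then -14 else pair_pot (step e C) x - pair_pot C x) + 17 * b x).
  exact: ler_sum.
rewrite [leRHS]big_split /= [X in _ <= X + _]big_split /= -mulr_sumr.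
have := pair_pot_bound C y; move: (pair_pot C y) (\sum_(x in L) b x) B => p q.
set s1 := \sum_(_ in _) _; set s2 := \sum_(_ in _) _; set s3 := \sum_(_ in _) _.
lra.
Qed.

Lemma sum_gap C : \sum_(u in leaders C) (gap C u)%:R <= n%:R :> R.
Proof.
pose S u := [set pos u (val j) | j in [set j : 'I_n | (j < gap C u)%N]].
have cS u : u \in leaders C -> #|S u| = gap C u.
  rewrite inE => lu; have [/andP[_ gn] _ _] := gapP n_gt1 leNn lu.
  rewrite card_in_imset => [|i j _ _ E]; last first.
    by apply: val_inj; apply: (pos_inj n_gt1 (ltn_ord i) (ltn_ord j) E).
  have -> : [set j : 'I_n | (j < gap C u)%N] = [set widen_ord gn j | j in 'I_(gap C u)].
    apply/setP => j; rewrite !inE; apply/idP/imsetP => [h|[i _ ->]]; last by case: i.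
    by exists (Ordinal h) => //; apply: val_inj.
  rewrite card_imset ?card_ord // => i j /(congr1 val) E; exact: val_inj.
rewrite (eq_bigr (fun u => \sum_z (z \in S u)%:R)); last first.
  move=> u uL; rewrite -(cS u uL) -sum1_card natr_sum big_mkcond /=.
  by apply: eq_bigr => z _; case: (z \in S u).
rewrite exchange_big /=; apply: le_trans (_ : _ <= \sum_(z : 'I_n) 1) _; last first.
  by rewrite sumr_const card_ord.
apply: ler_sum => z _; apply: sum_unique_le1 => x y; rewrite !inE => lx ly.
move=> /imsetP[i]; rewrite inE => ig -> /imsetP[j]; rewrite inE => jg E.
by have [] := gap_disjoint n_gt1 leNn lx ly ig jg E.
Qed.

Lemma sum_gap_next C : \sum_(u in leaders C) (gap C (next C u))%:R <= n%:R :> R.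
Proof.
rewrite -(big_imset (fun w => (gap C w)%:R)) /=; last first.
  by move=> x y; rewrite !inE => lx ly; apply: next_inj.
apply: le_trans (sum_gap C).
have sub : next C @: leaders C \subset leaders C.
  by apply/subsetP => w /imsetP[u]; rewrite !inE => lu ->; apply: next_ld.
rewrite [leRHS](big_setID (next C @: leaders C)) /= (setIidPr sub) lerDl sumr_ge0 //.
Qed.

Lemma total_drift C : tidy C -> #|leaders C| != 1 ->
  \sum_e (total (step e C) - total C) <= - (#|leaders C|%:R ^+ 2 / (64 * n%:R)).
Proof.
move=> tC many; apply: le_trans (_ : _ <= \sum_e \sum_(u in leaders C)
    (if touched C u e then -14 else pair_pot (step e C) u - pair_pot C u)) _.
  by apply: ler_sum => e _; apply: total_step.
rewrite exchange_big /=.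
apply: le_trans (_ : _ <= \sum_(u in leaders C) - drift_unit R (gap C u) (gap C (next C u))) _.
  by apply: ler_sum => u; rewrite inE => lu; apply: pair_drift.
rewrite sumrN lerN2.
set m : R := #|leaders C|%:R; set t : R := m / (2 * n%:R).
have n0 : 0 < n%:R :> R by rewrite ltr0n.
(* The tangent line of [1 / x] at [2 n / m] turns the sum of inverse gaps into a sum of gaps. *)
apply: le_trans (_ : _ <= \sum_(u in leaders C)
   (2 * t - t ^+ 2 * ((gap C u)%:R + (gap C (next C u))%:R)) / 32) _; last first.
  apply: ler_sum => u _; rewrite /drift_unit natrD.
  set G : R := (gap C u)%:R + (gap C (next C u))%:R.
  have G0 : 0 < G by rewrite addr_gt0 ?ltr0n.
  rewrite -[leRHS]mul1r ler_pdivlMr ?mulr_gt0 // mulrAC ler_pdivrMr //.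
  have : 0 <= (t * G - 1) ^+ 2 by apply: sqr_ge0.
  by rewrite !expr2; nra.
rewrite -mulr_suml sumrB sumr_const -mulr_sumr big_split /= -[(2 * t) *+ _]mulr_natl -/m.
have S1 := sum_gap C; have S2 := sum_gap_next C.
set s1 := \sum_(_ in _) _ in S1 *; set s2 := \sum_(_ in _) _ in S2 *.
have t0 : 0 <= t ^+ 2 by apply: sqr_ge0.
have le : t ^+ 2 * (s1 + s2) <= t ^+ 2 * (2 * n%:R) by apply: ler_wpM2l => //; lra.
have e1 : t ^+ 2 * (2 * n%:R) = m ^+ 2 / (2 * n%:R) by rewrite /t; field; rewrite gt_eqF.
have e2 : m * (2 * t) = m ^+ 2 / n%:R by rewrite /t; field; rewrite gt_eqF.
have e3 : m ^+ 2 / (64 * n%:R) = m ^+ 2 / n%:R / 64 by field; rewrite gt_eqF.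
have e4 : m ^+ 2 / (2 * n%:R) = m ^+ 2 / n%:R / 2 by field; rewrite gt_eqF.
rewrite e2 e3; rewrite e1 e4 in le; move: le; set z := m ^+ 2 / n%:R; set q := t ^+ 2 * _; lra.
Qed.

Lemma total_bound C : 50 * #|leaders C|%:R <= total C <= 54 * #|leaders C|%:R.
Proof.
have E (x : R) : x * #|leaders C|%:R = \sum_(u in leaders C) x by rewrite sumr_const mulr_natr.
rewrite /total !E; apply/andP; split.
  by apply: ler_sum => u _; have := pair_pot_bound C u; lra.
by apply: ler_sum => u _; have := pair_pot_bound C u; lra.
Qed.

(* [- 1 / x] is concave and the drift of [total] is at most [- c total ^ 2 / n ^ 2]. *)
Definition phi C : R := 400 * 500 * n%:R ^+ 2 * (1 / 50 - (total C)^-1).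

Lemma tidy_leaders C : tidy C -> (0 < #|leaders C|)%N.
Proof.
case/andP=> /andP[/andP[_ /existsP[u lu]] _] _.
by rewrite card_gt0; apply/set0Pn; exists u; rewrite inE.
Qed.

Lemma total_ge C : tidy C -> 50 <= total C.
Proof.
move=> /tidy_leaders m0; have /andP[h _] := total_bound C; apply: le_trans h.
have : 1 <= #|leaders C|%:R :> R by rewrite ler1n.
lra.
Qed.

Lemma phi_bound C : tidy C -> 0 <= phi C <= 4 * 1000 * n%:R ^+ 2.
Proof.
move=> tC; have T := total_ge tC.
have n0 : 0 <= n%:R ^+ 2 :> R by rewrite exprn_ge0.
have T0 : 0 < total C by lra.
have i1 : (total C)^-1 <= 1 / 50 by rewrite -[leLHS]mul1r ler_pdivrMr //; lra.
have i0 : 0 < (total C)^-1 by rewrite invr_gt0.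
rewrite /phi; move: (n%:R ^+ 2) n0 ((total C)^-1) i0 i1 => x x0 y y0 y1.
have xy : 0 <= x * y by rewrite mulr_ge0 // ltW.
have xy1 : x * y <= x * (1 / 50) by rewrite ler_wpM2l.
lra.
Qed.

Lemma phi_drift C : tidy C -> #|leaders C| != 1 ->
  \sum_e phi (step e C) <= n%:R * (phi C - 1).
Proof.
move=> tC many; have T := total_ge tC; have T0 : 0 < total C by lra.
have n0 : 0 < n%:R :> R by rewrite ltr0n.
have m0 : 0 < #|leaders C|%:R :> R by rewrite ltr0n tidy_leaders.
set K : R := 400 * 500 * n%:R ^+ 2.
have K0 : 0 <= K by rewrite mulr_ge0 ?exprn_ge0 // mulr_ge0.
have step_le e : phi (step e C) <= phi C + K * ((total (step e C) - total C) / total C ^+ 2).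
  have T' : 50 <= total (step e C) by apply: total_ge; apply: tidy_step.
  have T'0 : 0 < total (step e C) by lra.
  rewrite /phi -/K -mulrDr ler_wpM2l //.
  rewrite -addrA lerD2l -subr_ge0.
  have -> : - (total C)^-1 + (total (step e C) - total C) / total C ^+ 2 - - (total (step e C))^-1
     = (total (step e C) - total C) ^+ 2 / (total C ^+ 2 * total (step e C)).
    by field; rewrite !gt_eqF.
  by rewrite divr_ge0 ?sqr_ge0 // mulr_ge0 ?sqr_ge0 // ltW.
apply: le_trans (_ : _ <= \sum_e (phi C + K * ((total (step e C) - total C) / total C ^+ 2))) _.
  by apply: ler_sum => e _; apply: step_le.
rewrite big_split /= sumr_const card_ord -[_ *+ n]mulr_natl mulrBr mulr1 lerD2l.
rewrite -mulr_sumr -mulr_suml.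
apply: le_trans (_ : _ <= K * (- (#|leaders C|%:R ^+ 2 / (64 * n%:R)) / total C ^+ 2)) _.
  rewrite ler_wpM2l // ler_wpM2r ?total_drift // invr_ge0 sqr_ge0 //.
have /andP[_ T54] := total_bound C.
have T2 : total C ^+ 2 <= 54 * 54 * #|leaders C|%:R ^+ 2.
  have -> : 54 * 54 * #|leaders C|%:R ^+ 2 = (54 * #|leaders C|%:R) ^+ 2 :> R by ring.
  by rewrite lerXn2r // qualifE /= ltW // mulr_gt0.
have T20 : 0 < total C ^+ 2 by rewrite exprn_gt0.
rewrite mulNr mulrN lerN2 mulrA ler_pdivlMr //.
have -> : K * (#|leaders C|%:R ^+ 2 / (64 * n%:R)) = n%:R * (25 * 125 * #|leaders C|%:R ^+ 2).
  by rewrite /K; field; rewrite gt_eqF.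
apply: ler_wpM2l; [exact: ltW | apply: le_trans T2 _].
by rewrite ler_wpM2r ?exprn_ge0 //; lra.
Qed.

Lemma phase_single C : tidy C ->
  nohit R (@step N n) [pred C | tidy C && (#|leaders C| == 1%N)] (32 * 1000 * n ^ 2) C <= 8^-1.
Proof.
apply: (@nohit_add_drift_bound R _ _ _ n_gt0 (@tidy N n) _ phi) => {C}.
- by move=> C tC _ i; apply: tidy_step.
- by move=> C /phi_bound /andP[].
- by move=> C tC /=; rewrite tC; apply: phi_drift.
- move=> C /phi_bound /andP[_ h]; rewrite natrM natrX natrM.
  move: (n%:R ^+ 2) (phi C) h => x y h; lra.
- by rewrite muln_gt0 expn_gt0 n_gt0.
Qed.

End Elimination.

Section Convergence.
Variables (N n : nat).
Hypothesis (n_gt1 : 1 < n) (leNn : n <= N).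
Implicit Types (C : config N n).
Let n_gt0 : 0 < n. Proof. exact: ltnW. Qed.
Local Open Scope ring_scope.

Definition horizon : nat :=
  (2 * n * (N + N + 3) + (2 * n * (N + N + 3) + (2 * n * (0 + 2 * n + 3) +
    (2 * n * (N + N + 3) + (32 * 1000 * n ^ 2 + 0)))))%N.

Lemma horizon_gt0 : (0 < horizon)%N.
Proof. by rewrite /horizon addn_gt0 !muln_gt0 n_gt0 addn_gt0 orbT. Qed.

Lemma horizon_le : (horizon <= (32 + 32 * 1000) * (n * N))%N.
Proof.
rewrite /horizon; move: (32 * 1000)%N => k.
have h1 : (n * 3 <= 2 * (n * N))%N by nia.
have h2 : (n * n <= n * N)%N by rewrite leq_mul2l leNn orbT.
have h3 : (k * (n * n) <= k * (n * N))%N by rewrite leq_mul2l h2 orbT.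
set lhs := (X in (X <= _)%N).
have -> : lhs = (12 * (n * N) + 4 * (n * n) + 8 * (n * 3) + k * (n * n))%N by rewrite /lhs; ring.
rewrite mulnDl; move: (n * N)%N (n * n)%N (n * 3)%N h1 h2 h3 => x y z h1 h2.
by move: (k * x)%N (k * y)%N => u v; lia.
Qed.

Lemma nohit_safe (R : realFieldType) C : nohit R (@step N n) (@safe N n) horizon C <= 3/4.
Proof.
have q0 : 0 <= 8^-1 :> R by rewrite invr_ge0.
have l0 D : [pred C | tidy C && (#|leaders C| == 1%N)] D ->
    nohit R (@step N n) (@safe N n) 0 D <= 0.
  move=> /andP[/andP[cD _] /eqP c1]; rewrite nohit_in //; exact: safe_calm.
have l1 D : tidy D -> nohit R (@step N n) (@safe N n) (32 * 1000 * n ^ 2 + 0) D <= 8^-1 + 0.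
  by move=> tD; apply: (nohit_comp n_gt0 l0) => //; apply: phase_single.
have l2 D : calm D -> nohit R (@step N n) (@safe N n)
    (2 * n * (N + N + 3) + (32 * 1000 * n ^ 2 + 0)) D <= 8^-1 + (8^-1 + 0).
  by move=> cD; apply: (nohit_comp n_gt0 l1); [apply: phase_tidy | rewrite addr0].
have l3 D : led D -> nohit R (@step N n) (@safe N n) (2 * n * (0 + 2 * n + 3) +
    (2 * n * (N + N + 3) + (32 * 1000 * n ^ 2 + 0))) D <= 8^-1 + (8^-1 + (8^-1 + 0)).
  by move=> cD; apply: (nohit_comp n_gt0 l2); [apply: phase_calm | rewrite addr0 addr_ge0].
have l4 D : live_good D -> nohit R (@step N n) (@safe N n) (2 * n * (N + N + 3) +
    (2 * n * (0 + 2 * n + 3) + (2 * n * (N + N + 3) + (32 * 1000 * n ^ 2 + 0)))) D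
    <= 8^-1 + (8^-1 + (8^-1 + (8^-1 + 0))).
  move=> cD; apply: (nohit_comp n_gt0 l3); [exact: phase_leader | by rewrite addr0 !addr_ge0].
have := @nohit_comp R _ _ _ n_gt0 _ _ 8^-1 _ (2 * n * (N + N + 3)) _ C l4 (phase_live R n_gt1 leNn C).
rewrite !addr0 !addr_ge0 // => /(_ isT) h; apply: le_trans h _; lra.
Qed.

Lemma prob_conv_nohit C t :
  1 - prob_conv_by C t = nohit rat (@step N n) (@safe N n) t C.
Proof.
rewrite /prob_conv_by; set A := #|_|.
have nt : (n ^ t)%:R != 0 :> rat by rewrite pnatr_eq0 -lt0n expn_gt0 n_gt0.
have E := card_nohit rat (@step N n) n_gt0 (@safe N n) t C.
have H : (A%:R + (n ^ t)%:R * nohit rat (@step N n) (@safe N n) t C = (n ^ t)%:R :> rat).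
  rewrite -E -natrD; congr (_%:R); rewrite -[in RHS](card_ord n) -card_tuple.
  by rewrite -(cardC [pred g : t.-tuple 'I_n | [exists s : 'I_t.+1, safe (exec C g s)]]).
apply: (mulfI nt); rewrite mulrBr mulr1 mulrCA divff // mulr1.
by apply/eqP; rewrite subr_eq addrC eq_sym; apply/eqP.
Qed.

Lemma sum_conv C m : \sum_(t < m) (1 - prob_conv_by C t) <= 4 * horizon%:R.
Proof.
under eq_bigr => t _ do rewrite prob_conv_nohit.
apply: sum_nohit_restart => //; [exact: horizon_gt0 | exact: nohit_safe].
Qed.

Lemma conv_as C : converges_as C.
Proof.
move=> eps eps0; set B : rat := 4 * horizon%:R.
have B0 : 0 <= B by rewrite mulr_ge0.
have Be : 0 <= B / eps by rewrite divr_ge0 // ltW.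
pose m := (Num.bound (B / eps)); exists m.
have /ltW := archi_boundP Be; rewrite -/m ler_pdivrMr // => mB.
have m0 : 0 < m%:R :> rat by apply: le_lt_trans Be (archi_boundP Be).
suff : nohit rat (@step N n) (@safe N n) m C <= eps.
  by rewrite -prob_conv_nohit lerBlDr addrC -lerBlDr.
rewrite -(ler_pM2l m0); apply: le_trans mB; apply: le_trans (sum_conv C m).
under [leRHS]eq_bigr => t _ do rewrite prob_conv_nohit.
rewrite -sum_const_ord.
by apply: ler_sum => t _; apply: nohit_mono => //; apply: ltnW.
Qed.

End Convergence.

Lemma card_state N : #|state N| = (24 * N.+1)%N.
Proof. by rewrite !card_prod !card_bool !card_ord. Qed.

Theorem theorem1 :
  exists c1 c2 : rat,
    forall N : nat, (2 <= N)%N ->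
      (forall n : nat, (2 <= n)%N -> (n <= N)%N ->
         ss_leader_election N n /\
         (forall C : config N n, expected_conv_le C (c1 * (n * N)%:R)%R)) /\
      (#|state N|%:R <= c2 * N%:R)%R.
Proof.
have [k hk] : exists k, forall N n, 1 < n -> n <= N -> horizon N n <= k * (n * N).
  by eexists => N n n2 nN; apply: horizon_le.
exists (4 * k%:R)%R, 48%:R%R => N N2; split; last first.
  by rewrite card_state -natrM ler_nat; lia.
move=> n n2 nN; split; first by move=> C; apply: conv_as.
move=> C m; apply: le_trans (sum_conv n2 nN C m) _.
by rewrite -mulrA ler_pM2l // -natrM ler_nat hk.
Qed.
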